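(* Let $n\ge1$, let $M\subset\mathbb R^n$ be a closed subset with the metric inherited from the Euclidean metric, with reach $\tau_M$, and let $f\colon M\to\mathbb R^N$ be Lipschitz with Lipschitz constant $L_f$ (with respect to the $\infty$-norm on $\mathbb R^N$). Let $0<\delta\le\frac{1-\mathcal J_n}{(1+\mathcal J_n)\mathcal J_n}\tau_M$. Then there is an interleaving $$M^\bullet\simeq_{\mathcal E^\delta_{\tau_M}L_f\,\mathcal J_n\,\delta}\mathcal R^\delta(M^\bullet)$$ in the persistent homotopy category $\mathrm{ho}(\mathrm{Top}^{\mathbb R^N})$.
   Context: Constants. $\mathcal J_n:=\sqrt{\frac{n}{2(n+1)}}$. The reach $\tau_M\in[0,\infty]$ of a closed $M\subset\mathbb R^n$ is the supremum of all $\tau\ge0$ such that for every $x\in\mathbb R^n$ with $d(x,M)<\tau$ the function $M\to\mathbb R$, $y\mapsto d(x,y)$ has a unique minimizer. For $0\le r<\tau_M/\mathcal J_n$, $\mathcal E^r_{\tau_M}:=\left(1-\mathcal J_n\frac{r}{\tau_M}\right)^{-1}$, read as $1$ if $\tau_M=\infty$ or $r=0$. Persistent homotopy. $N\ge0$; $\mathbb R^N$ carries the componentwise partial order and is viewed as a category. $\mathrm{ho}(\mathrm{Top}^{\mathbb R^N})$ is the localization of the category of functors $\mathbb R^N\to\mathrm{Top}$ at the objectwise weak homotopy equivalences. $F^{\bullet+\varepsilon}$ is the precomposition of $F^\bullet$ with $u\mapsto u+(\varepsilon,\dots,\varepsilon)$, and $s$ denotes structure maps $F^\bullet\to F^{\bullet+\varepsilon}$.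 An $\varepsilon$-interleaving $F^\bullet\simeq_\varepsilon G^\bullet$ in the persistent homotopy category consists of morphisms $\varphi\colon F^\bullet\to G^{\bullet+\varepsilon}$, $\psi\colon G^\bullet\to F^{\bullet+\varepsilon}$ in $\mathrm{ho}(\mathrm{Top}^{\mathbb R^N})$ with $\psi^{+\varepsilon}\circ\varphi=s$ and $\varphi^{+\varepsilon}\circ\psi=s$ there. $M^\bullet$ is the functor $u\mapsto M^u=\{x\in M\mid f(x)\le u\}$ (subspace topology, inclusions). $\mathcal R^\delta(X)$ is the simplicial complex of finite nonempty subsets of a metric space $X$ with all pairwise distances (including $d(x,x)=0$) $<\delta$; $\mathcal R^\delta(M^\bullet)$ is the functor $u\mapsto\mathcal R^\delta(M^u)$, regarded as space-valued via geometric realization. *)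

(* Defs.v *)
From HB Require Import structures.
From mathcomp Require Import all_boot all_order all_algebra finmap.
From mathcomp Require Import all_classical all_reals all_analysis.

Set Implicit Arguments.
Unset Strict Implicit.
Unset Printing Implicit Defensive.

Import Order.TTheory GRing.Theory Num.Theory.
Import numFieldNormedType.Exports.

Local Open Scope classical_set_scope.
Local Open Scope ring_scope.

Section Euclidean.
Variables (R : realType) (n : nat).

(* The library norm on ['rV[R]_n] is the sup norm; its topology is also the
   Euclidean one, but the metric of R^n has to be introduced separately. *)
Definition eucl_dist (x y : 'rV[R]_n) : R :=
  Num.sqrt (\sum_(i < n) (x ord0 i - y ord0 i) ^+ 2).

(* [+oo] when [M] is empty. *)
Definition dist_to (x : 'rV[R]_n) (M : set 'rV[R]_n) : \bar R :=
  ereal_inf [set (eucl_dist x y)%:E | y in M].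

Definition unique_nearest (M : set 'rV[R]_n) (x : 'rV[R]_n) : Prop :=
  exists! y, M y /\ forall z, M z -> eucl_dist x y <= eucl_dist x z.

Definition reach (M : set 'rV[R]_n) : \bar R :=
  ereal_sup [set t%:E | t in [set t : R | 0 <= t /\
    forall x, (dist_to x M < t%:E)%E -> unique_nearest M x]].

End Euclidean.

Definition jung (R : realType) (n : nat) : R :=
  Num.sqrt (n%:R / (2%:R * n.+1%:R)).

(* For [r = 0] the first branch is also 1, whatever [t] is. *)
Definition distortion (R : realType) (n : nat) (tau : \bar R) (r : R) : R :=
  match tau with
  | t%:E => (1 - jung R n * (r / t))^-1
  | _ => 1
  end.

Section WeakEquivalence.
Variable R : realType.

Definition cube (k : nat) : set 'rV[R]_k :=
  [set s | forall i, 0 <= s ord0 i <= 1].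

Definition cube_boundary (k : nat) : set 'rV[R]_k :=
  [set s | cube s /\ exists i, s ord0 i = 0 \/ s ord0 i = 1].

Section Space.
Variable X : topologicalType.

Definition path_joined (x y : X) : Prop :=
  exists g : R -> X,
    [/\ {within `[0, 1], continuous g}, g 0 = x & g 1 = y].

(* Representatives of elements of pi_k(X, x); only the values on the cube
   matter. *)
Definition spheroid (k : nat) (x : X) (a : 'rV[R]_k -> X) : Prop :=
  {within @cube k, continuous a} /\ forall s, cube_boundary s -> a s = x.

Definition spheroid_homotopic (k : nat) (x : X) (a b : 'rV[R]_k -> X) : Prop :=
  exists H : 'rV[R]_k * R -> X,
    [/\ {within @cube k `*` `[0, 1], continuous H},
        forall s, cube s -> H (s, 0) = a s,
        forall s, cube s -> H (s, 1) = b s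
      & forall s t, cube_boundary s -> 0 <= t <= 1 -> H (s, t) = x].

End Space.

(* Bijectivity on pi_0, and on pi_k at every base point for k > 0 (the induced
   maps on pi_k are group morphisms, so bijective means isomorphic). *)
Definition weak_equivalence (X Y : topologicalType) (f : X -> Y) : Prop :=
  [/\ continuous f,
      forall y, exists x, path_joined (f x) y,
      forall x x', path_joined (f x) (f x') -> path_joined x x',
      forall k x (c : 'rV[R]_k -> Y), (0 < k)%N -> spheroid (f x) c ->
        exists2 a, spheroid x a & spheroid_homotopic (f x) (f \o a) c
    & forall k x (a b : 'rV[R]_k -> X), (0 < k)%N ->
        spheroid x a -> spheroid x b ->
        spheroid_homotopic (f x) (f \o a) (f \o b) ->
        spheroid_homotopic x a b].

End WeakEquivalence.

Section PersistentHomotopy.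
Variables (R : realType) (N : nat).

Definition lev (u v : 'rV[R]_N) : bool := [forall i, u ord0 i <= v ord0 i].

Lemma lev_trans u v w : lev u v -> lev v w -> lev u w.
Proof.
by move=> /forallP uv /forallP vw; apply/forallP => i; apply: le_trans (vw i).
Qed.

Lemma lev_shift (e : R) u v :
  lev u v -> lev (u + const_mx e) (v + const_mx e).
Proof. by move=> /forallP uv; apply/forallP => i; rewrite !mxE lerD2r. Qed.

Lemma lev_add (e : R) u : 0 <= e -> lev u (u + const_mx e).
Proof. by move=> e0; apply/forallP => i; rewrite !mxE lerDl. Qed.

(* Functors from the poset R^N to topological spaces. *)
Record pspace := PSpace {
  ps_obj :> 'rV[R]_N -> topologicalType;
  ps_map : forall u v, lev u v -> ps_obj u -> ps_obj v;
  ps_map_continuous : forall u v (uv : lev u v), continuous (ps_map uv);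
  ps_map_id : forall u (uu : lev u u) x, ps_map uu x = x;
  ps_map_comp : forall u v w (uv : lev u v) (vw : lev v w) (uw : lev u w) x,
    ps_map vw (ps_map uv x) = ps_map uw x }.

Record phom (F G : pspace) := PHom {
  ph_map : forall u, F u -> G u;
  ph_continuous : forall u, continuous (@ph_map u);
  ph_natural : forall u v (uv : lev u v) x,
    ph_map (ps_map uv x) = ps_map uv (ph_map x) }.

Definition phom_id (F : pspace) : phom F F.
Proof. by exists (fun u => @id (F u)) => // u x. Defined.

Definition phom_comp (F G H : pspace) (b : phom G H) (a : phom F G) :
  phom F H.
Proof.
exists (fun u => @ph_map _ _ b u \o @ph_map _ _ a u) => [u x|u v uv x /=].
  by apply: continuous_comp; exact: ph_continuous.
by rewrite !ph_natural.
Defined.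

Definition objectwise_weq (F G : pspace) (w : phom F G) : Prop :=
  forall u, weak_equivalence R (@ph_map _ _ w u).

Definition pshift (e : R) (F : pspace) : pspace.
Proof.
exists (fun u => F (u + const_mx e)) (fun u v uv => ps_map (lev_shift e uv)).
- by move=> u v uv; exact: ps_map_continuous.
- by move=> u uu x; exact: ps_map_id.
- by move=> u v w uv vw uw x; exact: ps_map_comp.
Defined.

Definition phom_shift (e : R) (F G : pspace) (a : phom F G) :
  phom (pshift e F) (pshift e G).
Proof.
exists (fun u => @ph_map _ _ a (u + const_mx e)) => [u|u v uv x].
  exact: (@ph_continuous _ _ a).
exact: (@ph_natural _ _ a).
Defined.

Lemma objectwise_weq_shift (e : R) (F G : pspace) (w : phom F G) :
  objectwise_weq w -> objectwise_weq (phom_shift e w).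
Proof. by move=> ww u; exact: ww. Qed.

Definition structure_map (e : R) (e0 : 0 <= e) (F : pspace) :
  phom F (pshift e F).
Proof.
exists (fun u => ps_map (lev_add u e0)) => [u|u v uv x].
  exact: ps_map_continuous.
have uw := lev_trans uv (lev_add v e0).
by rewrite /= !(ps_map_comp _ _ uw).
Defined.

(* The localization at the objectwise weak equivalences, by generators and
   relations: a morphism is a formal composite of morphisms of functors and of
   formal inverses of objectwise weak equivalences, two such words being the
   same morphism when they are related by [ho_eq]. *)
Inductive ho_word : pspace -> pspace -> Type :=
| ho_hom F G of phom F G : ho_word F G
| ho_inv F G (w : phom F G) of objectwise_weq w : ho_word G F
| ho_comp F G H of ho_word G H & ho_word F G : ho_word F H.

Inductive ho_eq : forall F G, ho_word F G -> ho_word F G -> Prop :=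
| ho_refl F G (a : ho_word F G) : ho_eq a a
| ho_sym F G (a b : ho_word F G) : ho_eq a b -> ho_eq b a
| ho_trans F G (a b c : ho_word F G) : ho_eq a b -> ho_eq b c -> ho_eq a c
| ho_comp_congr F G H (b b' : ho_word G H) (a a' : ho_word F G) :
    ho_eq b b' -> ho_eq a a' -> ho_eq (ho_comp b a) (ho_comp b' a')
| ho_compA F G H K (c : ho_word H K) (b : ho_word G H) (a : ho_word F G) :
    ho_eq (ho_comp c (ho_comp b a)) (ho_comp (ho_comp c b) a)
| ho_comp_idl F G (a : ho_word F G) : ho_eq (ho_comp (ho_hom (phom_id G)) a) a
| ho_comp_idr F G (a : ho_word F G) : ho_eq (ho_comp a (ho_hom (phom_id F))) a
| ho_hom_comp F G H (b : phom G H) (a : phom F G) :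
    ho_eq (ho_hom (phom_comp b a)) (ho_comp (ho_hom b) (ho_hom a))
| ho_invl F G (w : phom F G) (ww : objectwise_weq w) :
    ho_eq (ho_comp (ho_inv ww) (ho_hom w)) (ho_hom (phom_id F))
| ho_invr F G (w : phom F G) (ww : objectwise_weq w) :
    ho_eq (ho_comp (ho_hom w) (ho_inv ww)) (ho_hom (phom_id G)).

(* Precomposition with the translation by [e] preserves objectwise weak
   equivalences, hence acts on the localization. *)
Fixpoint ho_shift (e : R) F G (a : ho_word F G) :
    ho_word (pshift e F) (pshift e G) :=
  match a with
  | ho_hom _ _ f => ho_hom (phom_shift e f)
  | ho_inv _ _ _ ww => ho_inv (objectwise_weq_shift e ww)
  | ho_comp _ _ _ b a => ho_comp (ho_shift e b) (ho_shift e a)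
  end.

(* F -> F^{+2e}, where F^{+2e} is taken to be (F^{+e})^{+e}. *)
Definition structure_map2 (e : R) (e0 : 0 <= e) (F : pspace) :
    phom F (pshift e (pshift e F)) :=
  phom_comp (structure_map e0 (pshift e F)) (structure_map e0 F).

Definition ho_interleaved (e : R) (F G : pspace) : Prop :=
  exists (e0 : 0 <= e)
         (phi : ho_word F (pshift e G)) (psi : ho_word G (pshift e F)),
    ho_eq (ho_comp (ho_shift e psi) phi) (ho_hom (structure_map2 e0 F)) /\
    ho_eq (ho_comp (ho_shift e phi) psi) (ho_hom (structure_map2 e0 G)).

End PersistentHomotopy.

Record scomplex (V : choiceType) := SComplex {
  simplex : set {fset V};
  simplex_neq0 : forall s, simplex s -> s != fset0;
  simplex_face : forall s t, simplex s -> t != fset0 -> (t `<=` s)%fset ->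
    simplex t }.

Section GeometricRealization.
Variables (R : realType) (V : choiceType).

(* Points are given by their barycentric coordinates, extended by 0 to all of
   [V]. *)
Record georeal (K : scomplex V) := Georeal {
  bary :> V -> R;
  bary_ge0 : forall v, 0 <= bary v;
  bary_simplex : exists2 s : {fset V}, simplex K s &
    (forall v, v \notin s -> bary v = 0) /\ \sum_(v <- s) bary v = 1 }.

Variable K : scomplex V.

HB.instance Definition _ := gen_eqMixin (georeal K).
HB.instance Definition _ := gen_choiceMixin (georeal K).

Definition in_simplex (s : {fset V}) (t : georeal K) : Prop :=
  forall v, v \notin s -> t v = 0.

(* The weak (coherent) topology: the trace on every closed simplex is open for
   its Euclidean topology. *)
Definition georeal_open (U : set (georeal K)) : Prop :=
  forall s, simplex K s -> forall t, in_simplex s t -> U t ->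
    exists2 e : R, 0 < e & forall t', in_simplex s t' ->
      (forall v, v \in s -> `|t v - t' v| < e) -> U t'.

Lemma georeal_openT : georeal_open setT.
Proof. by move=> s _ t _ _; exists 1. Qed.

Lemma georeal_openI : setI_closed georeal_open.
Proof.
move=> A B oA oB s Ks t st [At Bt].
have [e e0 eA] := oA s Ks t st At; have [d d0 dB] := oB s Ks t st Bt.
exists (Num.min e d) => [|t' st' tt']; first by rewrite lt_min e0.
by split; [apply: eA|apply: dB] => // v vs; have := tt' v vs;
  rewrite lt_min => /andP[].
Qed.

Lemma georeal_open_bigcup (I : Type) (A : I -> set (georeal K)) :
  (forall i, georeal_open (A i)) -> georeal_open (\bigcup_i A i).
Proof.
move=> oA s Ks t st [i _ Ait]; have [e e0 eA] := oA i s Ks t st Ait.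
by exists e => // t' st' tt'; exists i => //; exact: eA.
Qed.

HB.instance Definition _ := isOpenTopological.Build (georeal K)
  georeal_openT georeal_openI georeal_open_bigcup.

Lemma georeal_openE (U : set (georeal K)) : open U = georeal_open U.
Proof. by []. Qed.

End GeometricRealization.

Section Subcomplex.
Variables (R : realType) (V : choiceType) (K L : scomplex V).
Hypothesis KL : simplex K `<=` simplex L.

Definition georeal_incl (t : georeal R K) : georeal R L.
Proof.
exists (bary t); first exact: bary_ge0.
by have [s Ks st] := bary_simplex t; exists s => //; exact: KL.
Defined.

Lemma georeal_incl_continuous : continuous georeal_incl.
Proof.
apply/continuousP => U; rewrite !georeal_openE => oU s Ks t st Ut.
have [e e0 eU] := oU s (KL Ks) (georeal_incl t) st Ut.
by exists e => // t' st' tt'; exact: eU.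
Qed.

End Subcomplex.

(* Vietoris-Rips complex of the subset [X] of [V] for the metric [d]. *)
Definition rips (R : realType) (V : choiceType) (d : V -> V -> R) (delta : R)
  (X : set V) : scomplex V.
Proof.
exists [set s : {fset V} | [/\ s != fset0, forall x, x \in s -> X x
    & forall x y, x \in s -> y \in s -> d x y < delta]].
- by move=> s [].
- move=> s t [_ sX sd] t0 /fsubsetP ts; split=> // [x xt|x y xt yt].
    by apply: sX; exact: ts.
  by apply: sd; exact: ts.
Defined.

Lemma rips_mono (R : realType) (V : choiceType) (d : V -> V -> R) (delta : R)
  (X Y : set V) : X `<=` Y -> 
  simplex (rips d delta X) `<=` simplex (rips d delta Y).
Proof. by move=> XY s [s0 sX sd]; split=> // x /sX /XY. Qed.

Section SetInclusion.
Variables (T : topologicalType) (A B : set T) (AB : A `<=` B).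

Definition set_incl (x : A) : B := SigSub (mem_set (AB (set_valP x))).

Lemma set_incl_continuous : continuous set_incl.
Proof. by apply: continuous_comp_initial; exact: initial_continuous. Qed.

End SetInclusion.

(* A function M -> R^N is a total function of which only the values on [M] are
   used. *)
Section Filtrations.
Variables (R : realType) (n N : nat) (M : set 'rV[R]_n).
Variable f : 'rV[R]_n -> 'rV[R]_N.

Definition sublevel (u : 'rV[R]_N) : set 'rV[R]_n :=
  [set x | M x /\ lev (f x) u].

Lemma sublevel_mono u v : lev u v -> sublevel u `<=` sublevel v.
Proof. by move=> uv x [Mx xu]; split=> //; exact: lev_trans uv. Qed.

(* The subspace topology on each sublevel set. *)
Definition sublevel_pspace : pspace R N.
Proof.
exists (fun u => set_type (sublevel u) : topologicalType)
  (fun u v uv => set_incl (sublevel_mono uv)).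
- by move=> u v uv; exact: set_incl_continuous.
- by move=> u uu x; exact: val_inj.
- by move=> u v w uv vw uw x; exact: val_inj.
Defined.

Definition rips_pspace (delta : R) : pspace R N.
Proof.
exists (fun u => georeal R (rips (@eucl_dist R n) delta (sublevel u)))
  (fun u v uv => @georeal_incl R _ _ _ (rips_mono (sublevel_mono uv))).
- by move=> u v uv; exact: georeal_incl_continuous.
- by move=> u uu [t t0 ts]; congr Georeal; exact: Prop_irrelevance.
- by move=> u v w uv vw uw [t t0 ts]; congr Georeal; exact: Prop_irrelevance.
Defined.

(* On ['rV[R]_N] the library norm is the infinity norm. *)
Definition lipschitz_inf (L : R) : Prop :=
  0 <= L /\ forall x y, M x -> M y -> `|f x - f y| <= L * eucl_dist x y.

End Filtrations.

(* Main.v *)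
From mathcomp Require Import all_boot all_order all_algebra finmap.
From mathcomp Require Import all_classical all_reals all_analysis.
From mathcomp Require Import ring lra.
Require Import Defs.

Set Implicit Arguments.
Unset Strict Implicit.
Unset Printing Implicit Defensive.

Import Order.TTheory GRing.Theory Num.Theory.
Import numFieldNormedType.Exports.

Local Open Scope classical_set_scope.
Local Open Scope ring_scope.

(* Both interleaving maps are honest maps of functors. From the Rips complex to
   M one projects the barycenter of a simplex to its nearest point in M: by
   Jung's theorem the barycenter is within J delta of a vertex, and by Federer's
   inequality the projection is Lipschitz on that tube with the constant E. From
   M to the Rips complex one spreads x over a locally finite family of points of
   M within delta/2 of x; this moves f by at most L delta / 2 <= E L J delta.
   One composite is homotopic to the structure map along projected segments.
   For the other, let p be the projection of the barycenter of a simplex s. By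
   Federer's inequality again, p is at distance at most diam s from the vertices
   of s, so p, and any point of M closer to p than delta - diam s, can be added
   to s. This margin is not bounded below near a vertex of infinitely many
   simplices, so one first discards the small barycentric coordinates; after
   that it has a continuous positive lower bound, the scale at which p is
   spread. *)

(** * Homotopic maps agree in the localization *)

(** The obstacle is continuity. A Rips complex is in general not locally finite and carries the weak
    topology, so pointwise convergence of barycentric coordinates does not suffice: near each point
    a single finite set of vertices has to serve. Maps are therefore given by formulas in the
    coordinates and tested with one notion of convergence, [lf_cvg]; the same formula is used at
    every level, which makes the homotopies natural in [u]. The bound on [delta] enters as follows.
    With [kappa] the inverse of the reach it reads [kappa * J * delta <= (1 - J) / (1 + J)], and
    [1 / 2 <= J] turns this into [kappa * J * delta <= 1 / 3] and [kappa * delta <= 2 / 3]. The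
    former makes the projection Lipschitz on the tube, the latter allows the projected barycenter to
    be added to its simplex. *)

Section HomotopyInvariance.
Variables (R : realType) (N : nat).

Lemma phom_ext (F G : pspace R N) (a b : phom F G) :
  (forall u x, @ph_map _ _ _ _ a u x = @ph_map _ _ _ _ b u x) -> a = b.
Proof.
case: a b => [a a1 a2] [b b1 b2] /= ab.
have ? : a = b by apply: functional_extensionality_dep => u; exact/funext.
by subst b; congr PHom; exact: Prop_irrelevance.
Qed.

Lemma within_continuous_precomp (T T' S : topologicalType) (A : set T)
    (B : set T') (p : T' -> T) (f : T -> S) :
  {homo p : x / B x >-> A x} -> continuous p -> {within A, continuous f} ->
  {within B, continuous (f \o p)}.
Proof.
move=> pBA cp /subspace_continuousP cf; apply/subspace_continuousP => x Bx U /=.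
move=> /(cf _ (pBA _ Bx)) fU.
have : nbhs x (p @^-1` [set y | A y -> U (f y)]) by apply: cp; exact: fU.
by apply: filterS => y /= + /pBA.
Qed.

Lemma within_continuous_pair (T S S' : topologicalType) (A : set T)
    (f : T -> S) (g : T -> S') :
  {within A, continuous f} -> {within A, continuous g} ->
  {within A, continuous (fun x => (f x, g x))}.
Proof. by move=> cf cg x; apply: cvg_pair; [exact: cf|exact: cg]. Qed.

Lemma continuous_pair (T S S' : topologicalType) (f : T -> S) (g : T -> S') :
  continuous f -> continuous g -> continuous (fun x => (f x, g x)).
Proof. by move=> cf cg x; apply: cvg_pair; [exact: cf|exact: cg]. Qed.

Lemma within_continuous_segment (T : topologicalType) (A : set T)
    (t a b : T -> R) :
  {within A, continuous t} -> {within A, continuous a} ->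
  {within A, continuous b} ->
  {within A, continuous (fun x => (1 - t x) * a x + t x * b x)}.
Proof.
move=> ct ca cb x; apply: cvgD; apply: cvgM.
- by apply: cvgB; [exact: cvg_cst|exact: ct].
- exact: ca.
- exact: ct.
- exact: cb.
Qed.

Lemma continuous_fst (T S : topologicalType) : continuous (@fst T S).
Proof. by move=> x; exact: cvg_fst. Qed.

Lemma continuous_snd (T S : topologicalType) : continuous (@snd T S).
Proof. by move=> x; exact: cvg_snd. Qed.

(** The fibre [R] is contracted along segments: lifts keep the second coordinate constant, and for
    injectivity a homotopy of first coordinates is paired with the segment between the second
    ones. *)
Lemma fst_weak_equivalence (X : topologicalType) :
  @weak_equivalence R (X * R)%type X fst.
Proof.
have cfst (T S : topologicalType) (A : set (T * S)) : {within A, continuous fst}.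
  exact/continuous_subspaceT/continuous_fst.
have csnd (T S : topologicalType) (A : set (T * S)) : {within A, continuous snd}.
  exact/continuous_subspaceT/continuous_snd.
have cid (A : set R) : {within A, continuous id}.
  by apply: continuous_subspaceT => x; exact: cvg_id.
have cc (T S : topologicalType) (A : set T) (y : S) :
    {within A, continuous (fun=> y)}.
  by apply: continuous_subspaceT => x; exact: cvg_cst.
split.
- exact: continuous_fst.
- by move=> y; exists (y, 0), (fun=> y); split=> //; exact: cc.
- move=> [x a] [y b] [g [gc /= g0 g1]].
  exists (fun t => (g t, (1 - t) * a + t * b)); split=> /=.
  + apply: within_continuous_pair => //.
    by apply: within_continuous_segment; [exact: cid|exact: cc..].
  + by rewrite g0 subr0 mul1r mul0r addr0.
  + by rewrite g1 subrr mul1r mul0r add0r.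
- move=> k [x a] c k0 [cx cb] /=; exists (fun s => (c s, a)).
    split; last by move=> s /cb /= ->.
    exact: within_continuous_pair.
  exists (c \o fst); split => //=; last by move=> s t /cb.
  by apply: within_continuous_precomp cx; [case=> s t []|exact: continuous_fst].
- move=> k [x e] a b k0 [ac ax] [bc bx] [H [Hc H0 H1 Hx]].
  exists (fun p => (H p, (1 - p.2) * (a p.1).2 + p.2 * (b p.1).2)); split => /=.
  + apply: within_continuous_pair => //; apply: within_continuous_segment => //.
    * apply: (within_continuous_precomp (p := fst) (A := @cube R k) (f := snd \o a)).
      - by case=> s t [].
      - exact: continuous_fst.
      - by move=> z; apply: (cvg_comp _ _ (ac z)); exact: continuous_snd.
    * apply: (within_continuous_precomp (p := fst) (A := @cube R k) (f := snd \o b)).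
      - by case=> s t [].
      - exact: continuous_fst.
      - by move=> z; apply: (cvg_comp _ _ (bc z)); exact: continuous_snd.
  + by move=> s sk; rewrite H0//= subr0 mul1r mul0r addr0; case: (a s).
  + by move=> s sk; rewrite H1//= subrr mul1r mul0r add0r; case: (b s).
  (* On the boundary both second coordinates are [e], so the segment between them is constant. *)
  + move=> s t sb t01; rewrite Hx// ax// bx//=; congr pair; ring.
Qed.

(** The parameter runs over the whole line; homotopies over the unit interval are extended to it by
    [clamp]. *)
Definition cylinder (F : pspace R N) : pspace R N.
Proof.
exists (fun u => (F u * R)%type : topologicalType)
  (fun u v uv x => (ps_map uv x.1, x.2)).
- move=> u v uv; apply: (@continuous_pair _ _ _ (ps_map uv \o fst) snd).
    move=> x; apply: continuous_comp; first exact: continuous_fst.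
    exact: ps_map_continuous.
  exact: continuous_snd.
- by move=> u uu [x r] /=; rewrite ps_map_id.
- by move=> u v w uv vw uw [x r] /=; rewrite (ps_map_comp _ _ uw).
Defined.

Definition cylinder_proj (F : pspace R N) : phom (cylinder F) F.
Proof.
by exists (fun u => @fst (F u) R) => // u; exact: continuous_fst.
Defined.

Lemma cylinder_proj_weq (F : pspace R N) : objectwise_weq (cylinder_proj F).
Proof. by move=> u; exact: fst_weak_equivalence. Qed.

Definition cylinder_section (F : pspace R N) (r : R) : phom F (cylinder F).
Proof.
exists (fun u x => (x, r)) => // u.
apply: (@continuous_pair _ _ _ id (fun=> r)) => x; [exact: cvg_id|exact: cvg_cst].
Defined.

(* The two ends of the cylinder are sections of the same weak equivalence. *)
Lemma ho_eq_cylinder_section (F : pspace R N) (r r' : R) :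
  ho_eq (ho_hom (cylinder_section F r)) (ho_hom (cylinder_section F r')).
Proof.
have ww := cylinder_proj_weq F.
suff H (s : R) : ho_eq (ho_hom (cylinder_section F s)) (ho_inv ww).
  exact: ho_trans (H r) (ho_sym (H r')).
apply: ho_trans (ho_sym (ho_comp_idl _)) _.
apply: ho_trans (ho_comp_congr (ho_sym (ho_invl ww)) (ho_refl _)) _.
apply: ho_trans (ho_sym (ho_compA _ _ _)) _.
apply: ho_trans (ho_comp_congr (ho_refl _) (ho_sym (ho_hom_comp _ _))) _.
rewrite (_ : phom_comp _ _ = phom_id F); last exact: phom_ext.
exact: ho_comp_idr.
Qed.

(** Naturality makes [H] a map of functors out of the cylinder, and [a] and [b] are its composites
    with two sections that are equal in the localization. *)
Lemma homotopic_ho_eq (F G : pspace R N) (a b : phom F G)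
    (H : forall u, F u * R -> G u) :
  (forall u, continuous (H u)) ->
  (forall u v (uv : lev u v) x r, H v (ps_map uv x, r) = ps_map uv (H u (x, r))) ->
  (forall u x, H u (x, 0) = ph_map a x) ->
  (forall u x, H u (x, 1) = ph_map b x) ->
  ho_eq (ho_hom a) (ho_hom b).
Proof.
move=> cH nH H0 H1.
have nH' u v (uv : lev u v) (x : cylinder F u) :
  H v (ps_map uv x) = ps_map uv (H u x) by case: x => x r; rewrite -nH.
pose h : phom (cylinder F) G := @PHom R N (cylinder F) G H cH nH'.
have -> : a = phom_comp h (cylinder_section F 0).
  by apply: phom_ext => u x; rewrite /= H0.
have -> : b = phom_comp h (cylinder_section F 1).
  by apply: phom_ext => u x; rewrite /= H1.
apply: ho_trans (ho_hom_comp _ _) _.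
apply: ho_trans (ho_comp_congr (ho_refl _) (ho_eq_cylinder_section _ 0 1)) _.
exact: ho_sym (ho_hom_comp _ _).
Qed.

End HomotopyInvariance.

(** * Continuity into and out of geometric realizations *)

Lemma near_seq (T : Type) (G : set_system T) (I : eqType) (s : seq I)
    (P : I -> T -> Prop) : Filter G ->
  (forall i, i \in s -> \forall z \near G, P i z) ->
  \forall z \near G, forall i, i \in s -> P i z.
Proof.
move=> FG; elim: s => [|i s IH] Ps; first by apply: nearW.
have Pi : \forall z \near G, P i z by apply: Ps; rewrite mem_head.
have {}IH : \forall z \near G, forall i, i \in s -> P i z.
  by apply: IH => j js; apply: Ps; rewrite inE js orbT.
apply: filterS2 Pi IH => z Piz Psz j; rewrite inE => /predU1P[->//|].
exact: Psz.
Qed.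

Section LocallyFinite.
Variables (R : realType) (V : choiceType).

(* Convergence of finitely supported functions in the topology of the union of
   the spaces R^F, F finite. *)
Definition lf_cvg (T : Type) (G : set_system T) (A : T -> V -> R)
    (l : V -> R) : Prop :=
  exists2 F : {fset V},
    (forall v, v \notin F -> l v = 0) /\
    (\forall z \near G, forall v, v \notin F -> A z v = 0)
  & forall v, A z v @[z --> G] --> l v.

Section Theory.
Variables (T : Type) (G : set_system T).
Hypothesis FG : Filter G.

Lemma cvg_fsbig (W : normedModType R) (F : {fset V}) (h : T -> V -> W)
    (k : V -> W) :
  (forall v, v \notin F -> k v = 0) ->
  (\forall z \near G, forall v, v \notin F -> h z v = 0) ->
  (forall v, h z v @[z --> G] --> k v) ->
  \sum_(v \in [set: V]) h z v @[z --> G] --> \sum_(v \in [set: V]) k v.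
Proof.
move=> k0 h0 hk; rewrite (fsbigTE F)//.
have e : {near G, (fun z => \sum_(v <- F) h z v)
                  =1 (fun z => \sum_(v \in [set: V]) h z v)}.
  by apply: filterS h0 => z hz; rewrite (fsbigTE F).
apply: cvg_trans (near_eq_cvg e) _.
by apply: cvg_big => [|v _]; [exact: add_continuous|exact: hk].
Qed.

Lemma lf_cvg_segment (r : T -> R) (r0 : R) A l B m :
  r @ G --> r0 -> lf_cvg G A l -> lf_cvg G B m ->
  lf_cvg G (fun z v => (1 - r z) * A z v + r z * B z v)
           (fun v => (1 - r0) * l v + r0 * m v).
Proof.
move=> rr [F1 [l0 A0] Al] [F2 [m0 B0] Bm]; exists (F1 `|` F2)%fset; first split.
- by move=> v; rewrite inE negb_or => /andP[/l0-> /m0->]; rewrite !mulr0 addr0.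
- apply: filterS2 A0 B0 => z A0 B0 v.
  by rewrite inE negb_or => /andP[/A0-> /B0->]; rewrite !mulr0 addr0.
- move=> v; apply: cvgD; apply: cvgM => //.
  by apply: cvgB => //; exact: cvg_cst.
Qed.

Lemma lf_cvg_sum A l : lf_cvg G A l ->
  \sum_(v \in [set: V]) A z v @[z --> G] --> \sum_(v \in [set: V]) l v.
Proof. by case=> F [l0 A0] Al; exact: (@cvg_fsbig R^o F). Qed.

Definition normalize (a : V -> R) : V -> R :=
  fun v => a v / \sum_(w \in [set: V]) a w.

Lemma lf_cvg_normalize A l : \sum_(v \in [set: V]) l v != 0 ->
  lf_cvg G A l -> lf_cvg G (fun z => normalize (A z)) (normalize l).
Proof.
move=> l_neq0 Al; have Sl := lf_cvg_sum Al; case: Al => F [l0 A0] Al.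
exists F; first split.
- by move=> v /l0; rewrite /normalize => ->; rewrite mul0r.
- by apply: filterS A0 => z A0 v /A0; rewrite /normalize => ->; rewrite mul0r.
- by move=> v; apply: cvgM => //; exact: cvgV.
Qed.

End Theory.
End LocallyFinite.

Section SimplexNbhs.
Variables (R : realType) (V : choiceType) (K : scomplex V).

(** The neighbourhood filter of [t] in the closed simplex [s]. A set is open in the realization when
    it belongs to this filter at each of its points, for every simplex containing the point. *)
Definition simplex_nbhs (s : {fset V}) (t : georeal R K) :
    set_system (georeal R K) :=
  [set A | exists2 e : R, 0 < e & forall t', in_simplex s t' ->
     (forall v, v \in s -> `|t v - t' v| < e) -> A t'].

#[global] Instance simplex_nbhs_filter s t : Filter (simplex_nbhs s t).
Proof.
split=> [|A B [e e0 eA] [d d0 dB]|A B AB [e e0 eA]].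
- by exists 1.
- exists (Num.min e d) => [|t' st' tt']; first by rewrite lt_min e0.
  by split; [apply: eA|apply: dB] => // v vs; have := tt' v vs;
    rewrite lt_min => /andP[].
- by exists e => // t' st' /eA; move/(_ st'); exact: AB.
Qed.

Lemma lf_cvg_bary s (t : georeal R K) : in_simplex s t ->
  lf_cvg (simplex_nbhs s t) (@bary R V K) t.
Proof.
move=> st; exists s; first split=> //; first by exists 1.
move=> v; apply/cvgrPdist_lt => e e0; exists e => // t' st' tt'.
have [/tt'//|vs] := boolP (v \in s); first by rewrite st// st'// subrr normr0.
Qed.

Lemma georeal_continuous (Y : topologicalType) (h : georeal R K -> Y) :
  (forall s t, simplex K s -> in_simplex s t -> h @ simplex_nbhs s t --> h t) ->
  continuous h.
Proof.
move=> ch; apply/continuousP => U oU; rewrite georeal_openE => s Ks t st Ut.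
have : nbhs (h t) U by exact: open_nbhs_nbhs.
exact: ch Ks st U.
Qed.

(* Tube lemma: [R] is locally compact, so that the weak topology of the complex
   is still tested on simplices after taking the product with [R]. *)
Lemma georeal_prod_continuous (Y : topologicalType)
    (H : georeal R K * R -> Y) :
  (forall s t r, simplex K s -> in_simplex s t ->
     H @ filter_prod (simplex_nbhs s t) (nbhs r) --> H (t, r)) ->
  continuous H.
Proof.
move=> cH -[t0 r0] U0; rewrite nbhsE => -[U [oU U00] UU0].
apply: filterS UU0 _.
have HU s t r : simplex K s -> in_simplex s t -> U (H (t, r)) ->
    filter_prod (simplex_nbhs s t) (nbhs r) (H @^-1` U).
  move=> Ks st Ur; exact: cH s t r Ks st U (open_nbhs_nbhs (conj oU Ur)).
have [s0 Ks0 [s00 _]] := bary_simplex t0.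
have [c c0 cU] : exists2 c : R, 0 < c &
    forall r, r0 - c <= r <= r0 + c -> U (H (t0, r)).
  have [[A B] /= [[e e0 eA] Br0] AB] := HU s0 t0 r0 Ks0 s00 U00.
  have At0 : A t0 by apply: eA => // v _; rewrite subrr normr0.
  have /nbhs_ballP [c /= c0 cB] := Br0.
  exists (c / 2) => [|r]; first by rewrite divr_gt0.
  move=> rc; apply: (AB (t0, r)); split => //=; apply: cB.
  by rewrite /ball/= distrC ltr_distlC; apply/andP; split; lra.
(* Points whose whole compact slice is sent into [U]; compactness of the interval makes [W] open on
   every simplex. *)
pose W := [set t | forall r, r0 - c <= r <= r0 + c -> U (H (t, r))].
have oW : open W.
  rewrite georeal_openE => s Ks t st Wt.
  have cs : compact `[r0 - c, r0 + c]%classic by exact: segment_compact.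
  have : simplex_nbhs s t
      [set t' | `[r0 - c, r0 + c]%classic `<=` (fun r => U (H (t', r)))].
    apply: (proj1 (compact_near_coveringP _) cs _ _
      (fun t' r => U (H (t', r))) (simplex_nbhs_filter s t)) => r.
    rewrite /= in_itv/= => rI.
    have [[A B] /= [sA Br] AB] := HU s t r Ks st (Wt r rI).
    by exists (B, A) => //= -[r' t'] [/= Br' At']; exact: (AB (t', r')).
  by apply: filterS => t' + r rI; apply; rewrite /= in_itv.
exists (W, ball r0 c) => /=.
  split; last exact: nbhsx_ballx.
  by apply: open_nbhs_nbhs; split.
move=> [t r] [/= Wt]; rewrite /ball/= ltr_distlC => /andP[r1 r2].
by apply: Wt; rewrite !ltW.
Qed.

(** Near the limit all values lie in simplices spanned by subsets of the finite set [F]. There are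
    finitely many of these, and openness of [U] is tested on each separately. *)
Lemma georeal_cvg (T : Type) (G : set_system T) (h : T -> georeal R K)
    (l : georeal R K) : Filter G ->
  lf_cvg G (fun z => bary (h z)) (bary l) -> h @ G --> l.
Proof.
move=> FG [F [l0 h0] hl] U0; rewrite nbhsE => -[U [oU Ul] UU0].
apply: filterS UU0 _.
have near_s s : \forall z \near G, simplex K s -> in_simplex s (h z) -> U (h z).
  have [Ks|nKs] := pselect (simplex K s); last by apply: nearW.
  (* If [l] is outside the closed simplex [s], some nonzero [l v] with [v] outside [s] keeps [h z]
     out of it near the limit. *)
  have [sl|/existsNP[v /not_implyP[vs lv]]] := pselect (in_simplex s l).
    have [e e0 eU] := oU s Ks l sl Ul.
    have : \forall z \near G, forall v, v \in s -> `|l v - h z v| < e.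
      by apply: near_seq => v _; move/cvgrPdist_lt: (hl v); exact.
    by apply: filterS => z lz _ sz; exact: eU.
  have lv0 : 0 < `|l v| by rewrite normr_gt0; exact/eqP.
  move/cvgrPdist_lt: (hl v) => /(_ _ lv0); apply: filterS => z + _ sz.
  by rewrite sz// subr0 ltxx.
have : \forall z \near G, forall s, s \in fpowerset F ->
    simplex K s -> in_simplex s (h z) -> U (h z).
  by apply: near_seq.
apply: filterS2 h0 => z h0 Uz.
have [s Ks [sz s1]] := bary_simplex (h z).
have sFz : in_simplex (s `&` F)%fset (h z).
  by move=> v; rewrite inE negb_and => /orP[/sz|/h0].
apply: (Uz (s `&` F)%fset) => //; first by rewrite fpowersetE fsubsetIr.
apply: simplex_face Ks _ (fsubsetIl _ _).
apply/negP => /eqP sF0; move: s1; rewrite big1_seq => [|v /= _].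
  by move/eqP; rewrite eq_sym oner_eq0.
by apply: sFz; rewrite sF0.
Qed.

End SimplexNbhs.

(** * The Euclidean metric *)

Section DotProduct.
Variables (R : realType) (n : nat).
Implicit Types u v w x y z : 'rV[R]_n.

Definition dot u v : R := \sum_(i < n) u ord0 i * v ord0 i.

Lemma dotC u v : dot u v = dot v u.
Proof. by apply: eq_bigr => i _; rewrite mulrC. Qed.

Lemma dotDl u v w : dot (u + v) w = dot u w + dot v w.
Proof. by rewrite -big_split; apply: eq_bigr => i _; rewrite mxE mulrDl. Qed.

Lemma dotZl a u v : dot (a *: u) v = a * dot u v.
Proof. by rewrite mulr_sumr; apply: eq_bigr => i _; rewrite mxE mulrA. Qed.

Lemma dotNl u v : dot (- u) v = - dot u v.
Proof. by rewrite -scaleN1r dotZl mulN1r. Qed.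

Lemma dotDr u v w : dot w (u + v) = dot w u + dot w v.
Proof. by rewrite dotC dotDl !(dotC w). Qed.

Lemma dotZr a u v : dot u (a *: v) = a * dot u v.
Proof. by rewrite dotC dotZl dotC. Qed.

Lemma dotNr u v : dot u (- v) = - dot u v.
Proof. by rewrite dotC dotNl dotC. Qed.

Lemma dot_sumr (I : Type) (s : seq I) (F : I -> 'rV[R]_n) u :
  dot u (\sum_(i <- s) F i) = \sum_(i <- s) dot u (F i).
Proof.
elim/big_rec2: _ => [|i _ b _ <-]; last by rewrite dotDr.
by rewrite /dot big1// => i _; rewrite mxE mulr0.
Qed.

Definition dotE := (dotDl, dotDr, dotNl, dotNr, dotZl, dotZr).

Lemma dot_ge0 u : 0 <= dot u u.
Proof. by apply: sumr_ge0 => i _; rewrite -expr2 sqr_ge0. Qed.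

Lemma dot_eq0 u : dot u u = 0 -> u = 0.
Proof.
move=> u0; apply/rowP => i; apply/eqP; rewrite !mxE -sqrf_eq0 expr2.
have /eqP := u0; rewrite psumr_eq0 => [|j _]; last by rewrite -expr2 sqr_ge0.
by move=> /allP /(_ i); rewrite mem_index_enum; exact.
Qed.

Lemma dot0l u : dot 0 u = 0.
Proof. by rewrite -(scale0r 0) dotZl mul0r. Qed.

(** Cauchy-Schwarz: the squared norm of [dot v v *: u - dot u v *: v] is [dot v v] times the
    difference of the two sides. *)
Lemma dot_sqr_le u v : dot u v ^+ 2 <= dot u u * dot v v.
Proof.
have [v0|v0] := eqVneq (dot v v) 0.
  by rewrite (dot_eq0 v0) dotC dot0l expr0n mulr_ge0 ?dot_ge0.
have vv : 0 < dot v v by rewrite lt_def v0 dot_ge0.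
have := dot_ge0 (dot v v *: u - dot u v *: v); rewrite !dotE (dotC v u).
move=> H; rewrite -subr_ge0 -(pmulr_rge0 _ vv); apply: le_trans H _.
by rewrite le_eqVlt; apply/orP; left; apply/eqP; ring.
Qed.

Lemma eucl_distE x y : eucl_dist x y = Num.sqrt (dot (x - y) (x - y)).
Proof. by congr Num.sqrt; apply: eq_bigr => i _; rewrite !mxE expr2. Qed.

Lemma eucl_dist_ge0 x y : 0 <= eucl_dist x y.
Proof. exact: sqrtr_ge0. Qed.

Lemma eucl_dist_sqr x y : eucl_dist x y ^+ 2 = dot (x - y) (x - y).
Proof. by rewrite eucl_distE sqr_sqrtr ?dot_ge0. Qed.

Lemma eucl_distC x y : eucl_dist x y = eucl_dist y x.
Proof. by rewrite !eucl_distE -[y - x]opprB dotNl dotNr opprK. Qed.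

Lemma eucl_distxx x : eucl_dist x x = 0.
Proof. by rewrite eucl_distE subrr dot0l sqrtr0. Qed.

Lemma eucl_dist_eq0 x y : eucl_dist x y = 0 -> x = y.
Proof.
move=> xy; apply/eqP; rewrite -subr_eq0; apply/eqP/dot_eq0.
by rewrite -eucl_dist_sqr xy expr0n.
Qed.

Lemma dot_le_dist x y z w :
  dot (x - y) (z - w) <= eucl_dist x y * eucl_dist z w.
Proof.
apply: le_trans (ler_norm _) _.
rewrite -ler_sqr ?nnegrE ?mulr_ge0 ?eucl_dist_ge0//.
by rewrite real_normK ?num_real// exprMn !eucl_dist_sqr dot_sqr_le.
Qed.

Lemma eucl_dist_triangle y x z : eucl_dist x z <= eucl_dist x y + eucl_dist y z.
Proof.
rewrite -ler_sqr ?nnegrE ?addr_ge0 ?eucl_dist_ge0//.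
rewrite sqrrD !eucl_dist_sqr.
have -> : x - z = (x - y) + (y - z) by rewrite addrA subrK.
rewrite !(dotDl (x - y)) !(dotDr (x - y)) (dotC (y - z) (x - y)).
have := dot_le_dist x y y z; lra.
Qed.

Lemma norm_le_eucl_dist x y : `|x - y| <= eucl_dist x y.
Proof.
rewrite [leLHS]/Num.norm/= mx_normrE; apply/bigmax_leP; split=> /= [|[i j] _ /=].
  exact: eucl_dist_ge0.
rewrite -ler_sqr ?nnegrE ?eucl_dist_ge0// real_normK ?num_real// eucl_dist_sqr.
rewrite ord1 /dot (bigD1 j)//= expr2 lerDl sumr_ge0// => k _.
by rewrite -expr2 sqr_ge0.
Qed.

Lemma cvg_dot (T : Type) (G : set_system T) (f g : T -> 'rV[R]_n) x y :
  Filter G -> f @ G --> x -> g @ G --> y ->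
  dot (f z) (g z) @[z --> G] --> dot x y.
Proof.
move=> FG fx gy; apply: cvg_big => [|i _]; first exact: add_continuous.
have ci (a : 'rV[R]_n) : u ord0 i @[u --> a] --> a ord0 i.
  exact: coord_continuous.
by apply: cvgM; [exact: (cvg_comp f _ fx (ci x))|exact: (cvg_comp g _ gy (ci y))].
Qed.

Lemma cvg_eucl_dist (T : Type) (G : set_system T) (f g : T -> 'rV[R]_n) x y :
  Filter G -> f @ G --> x -> g @ G --> y ->
  eucl_dist (f z) (g z) @[z --> G] --> eucl_dist x y.
Proof.
move=> FG fx gy; rewrite eucl_distE.
under eq_fun do rewrite eucl_distE.
have fgxy : dot (f z - g z) (f z - g z) @[z --> G] --> dot (x - y) (x - y).
  by apply: cvg_dot; apply: cvgB.
exact: (cvg_comp _ _ fgxy (@sqrt_continuous R _)).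
Qed.

Lemma cvg_eucl (T : Type) (G : set_system T) (f : T -> 'rV[R]_n) x :
  Filter G -> eucl_dist (f z) x @[z --> G] --> (0 : R) -> f @ G --> x.
Proof.
move=> FG fx; apply/cvgrPdist_lt => e e0.
move/cvgrPdist_lt: fx => /(_ e e0); apply: filterS => z.
rewrite sub0r normrN ger0_norm ?eucl_dist_ge0// => fz.
by apply: le_lt_trans fz; rewrite distrC norm_le_eucl_dist.
Qed.

Lemma eucl_dist_continuous x : continuous (eucl_dist x).
Proof.
move=> y; have := @cvg_eucl_dist 'rV[R]_n (nbhs y) (fun=> x) id x y _.
by apply; [exact: (@cst_continuous _ _ x y)|exact: cvg_id].
Qed.

Lemma compact_eucl_ball x r (A : set 'rV[R]_n) :
  closed A -> compact (A `&` [set y | eucl_dist x y <= r]).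
Proof.
move=> cA; apply: bounded_closed_compact.
  exists (`|x| + r); split; first exact: num_real.
  move=> k kr y [_ /= xy]; apply: le_trans (ltW kr).
  rewrite -(subrK x y); apply: le_trans (ler_normD _ _) _.
  by rewrite addrC lerD2l; apply: le_trans xy; rewrite eucl_distC norm_le_eucl_dist.
apply: closedI => //.
have -> : [set y | eucl_dist x y <= r] = eucl_dist x @^-1` [set y | y <= r] by [].
apply: closed_comp; last exact: closed_le.
by move=> y _; exact: eucl_dist_continuous.
Qed.

End DotProduct.

(** * Nearest points and Federer's inequality *)

Section NearestPoint.
Variables (R : realType) (n : nat) (M : set 'rV[R]_n).
Implicit Types x y z p q : 'rV[R]_n.

Definition nearest x p : Prop :=
  M p /\ forall z, M z -> eucl_dist x p <= eucl_dist x z.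

(** A chosen nearest point; its uniqueness is the separate condition [unique_proj]. The default 0 is
    not reached when [M] is closed and nonempty. *)
Definition proj x : 'rV[R]_n := xget 0 (nearest x).

Definition distM x : R := eucl_dist x (proj x).

Hypotheses (cM : closed M) (M0 : M !=set0).

Lemma compact_min_dist x (A : set 'rV[R]_n) : compact A -> A !=set0 ->
  exists2 p, A p & forall z, A z -> eucl_dist x p <= eucl_dist x z.
Proof.
move=> cA A0.
have cx : {within A, continuous (eucl_dist x)}.
  exact/continuous_subspaceT/eucl_dist_continuous.
have [p Ap pmin] := EVT_min_rV A0 cA cx.
exists p; first exact/set_mem.
by move=> z Az; apply: pmin; exact/mem_set.
Qed.

Lemma proj_nearest x : nearest x (proj x).
Proof.
suff : exists p, nearest x p by move=> [p]; exact: xgetI.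
have [m Mm] := M0; have := @compact_eucl_ball _ _ x (eucl_dist x m) _ cM.
move=> /(@compact_min_dist x)[|p [Mp /= pm] pmin]; first by exists m; split=> /=.
exists p; split=> // z Mz.
have [zm|/ltW mz] := leP (eucl_dist x z) (eucl_dist x m); first exact: pmin.
exact: le_trans mz.
Qed.

Lemma proj_in x : M (proj x).
Proof. by have [] := proj_nearest x. Qed.

Lemma distM_le x z : M z -> distM x <= eucl_dist x z.
Proof. by have [_] := proj_nearest x; apply. Qed.

Lemma distM_ge0 x : 0 <= distM x.
Proof. exact: eucl_dist_ge0. Qed.

Lemma distM_nearest x p : nearest x p -> eucl_dist x p = distM x.
Proof.
move=> [Mp pmin]; apply/eqP; rewrite eq_le distM_le// andbT.
exact/pmin/proj_in.
Qed.

Lemma distM_lip y x : distM x <= distM y + eucl_dist x y.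
Proof.
apply: le_trans (distM_le _ (proj_in y)) _.
by rewrite addrC eucl_dist_triangle.
Qed.

Lemma distM_continuous : continuous distM.
Proof.
move=> x.
apply: (proj2 (@cvgrPdist_lt _ _ _ _ (nbhs_filter x) distM (distM x))) => e e0.
move/cvgrPdist_lt: (@eucl_dist_continuous R n x x) => /(_ e e0).
apply: (@filterS _ (nbhs x) (nbhs_filter x)) => y; rewrite eucl_distxx.
rewrite sub0r normrN ger0_norm ?eucl_dist_ge0// => xy.
have := distM_lip y x; have := distM_lip x y.
rewrite ltr_norml (eucl_distC y x) => ? ?; apply/andP; split; lra.
Qed.

(** Serves to move inside a closed ball: [a] is the slack in the squared radius, and where it
    vanishes, on the sphere, the direction has to point strictly inwards ([b < 0]). *)
Lemma small_quadratic (a b c : R) : 0 < a \/ 0 <= a /\ b < 0 -> 0 <= c ->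
  exists2 e : R, 0 < e & forall t, 0 < t < e -> 2 * t * b + t ^+ 2 * c <= a.
Proof.
move=> ab c0; case: ab => [a0|[a0 b0]].
  have d0 : 0 < 2 * `|b| + c + 1 by have := normr_ge0 b; lra.
  exists (Num.min 1 (a / (2 * `|b| + c + 1))); first by rewrite lt_min ltr01 divr_gt0.
  move=> t /andP[t0]; rewrite lt_min ltr_pdivlMr// => /andP[t1 ta].
  have tb : t * b <= t * `|b| by rewrite ler_pM2l// ler_norm.
  have tc : t ^+ 2 * c <= t * c.
    rewrite expr2 -mulrA; apply: ler_piMl; last exact: ltW.
    by apply: mulr_ge0 => //; exact: ltW.
  by move: tb tc ta; lra.
exists (- b / (c + 1)); first by rewrite divr_gt0; lra.
move=> t /andP[t0]; rewrite ltr_pdivlMr; last lra.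
move=> tc; have : t * (2 * b + t * c) <= 0.
  by rewrite pmulr_rle0//; move: tc; rewrite mulrDr mulr1; lra.
by rewrite expr2; lra.
Qed.

Definition unique_proj x := forall p, nearest x p -> p = proj x.

(* The nearest points of [w + t *: v] are close to [proj w], which gives the
   growth of the squared distance to first order. *)
Lemma distM_ascent w v : unique_proj w -> 0 < dot v (w - proj w) ->
  exists2 e, 0 < e & forall t, 0 < t < e -> distM w < distM (w + t *: v).
Proof.
move=> uw vw.
(* By compactness: a closest point to [w] among those of [M] violating the inequality is not
   [proj w], so by uniqueness it is strictly farther than [distM w]. *)
have [m dm mP] : exists2 m, distM w < m &
    forall q, M q -> eucl_dist w q < m -> 0 < dot v (w - q).
  pose C := M `&` [set q | eucl_dist w q <= distM w + 1] `&`
    [set q | dot v (w - q) <= 0].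
  have clC : closed [set q | dot v (w - q) <= 0].
    have -> : [set q | dot v (w - q) <= 0] =
      (fun q => dot v (w - q)) @^-1` [set y | y <= 0] by [].
    apply: closed_comp; last exact: closed_le.
    move=> y _; have := @cvg_dot R n 'rV[R]_n (nbhs y)
      (fun=> v) (fun q => w - q) v (w - y) _.
    apply; first exact: (@cst_continuous _ _ v y).
    apply: cvgB; [exact: (@cst_continuous _ _ w y)|exact: cvg_id].
  have cC : compact C.
    rewrite /C setIAC; apply: compact_eucl_ball.
    exact: closedI.
  have [C0|/set0P nC] := eqVneq C set0.
    exists (distM w + 1); first by rewrite ltrDl.
    move=> q Mq wq; rewrite ltNge; apply/negP => vq.
    suff : C q by rewrite C0.
    by split=> //; split=> //=; exact: ltW.
  have [q0 [[Mq0 _] /= vq0] q0min] := compact_min_dist w cC nC.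
  have wq0 : distM w < eucl_dist w q0.
    rewrite lt_neqAle distM_le// andbT; apply/eqP => e.
    suff q0E : q0 = proj w by move: vq0; rewrite leNgt q0E vw.
    by apply: uw; split=> // z Mz; rewrite -e distM_le.
  exists (Num.min (distM w + 1) (eucl_dist w q0)).
    by rewrite lt_min wq0 ltrDl ltr01.
  move=> q Mq; rewrite lt_min => /andP[wq1 wq2]; rewrite ltNge; apply/negP => vq.
  move: wq2; rewrite ltNge q0min//.
  by split=> //; split=> //=; exact: ltW.
pose nv := eucl_dist v 0.
have nv0 : 0 <= nv by exact: eucl_dist_ge0.
have nv1 : 0 < 2 * (nv + 1) by lra.
(* The nearest point of [w + t *: v] is within [distM w + 2 * t * nv] of [w], which stays below [m];
   the added 1 keeps the denominator positive. *)
exists ((m - distM w) / (2 * (nv + 1))); first by rewrite divr_gt0// subr_gt0.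
move=> t /andP[t0]; rewrite ltr_pdivlMr// => tm.
set q := proj (w + t *: v).
have wt : eucl_dist (w + t *: v) w = t * nv.
  rewrite /nv !eucl_distE subr0 addrC addKr !dotE mulrA -expr2.
  by rewrite sqrtrM ?sqr_ge0// sqrtr_sqr gtr0_norm.
have vq : 0 < dot v (w - q).
  apply: mP; first exact: proj_in.
  have := eucl_dist_triangle (w + t *: v) w q; have := distM_lip w (w + t *: v).
  rewrite -[eucl_dist (w + t *: v) q]/(distM (w + t *: v)).
  by rewrite (eucl_distC w (w + _)) wt; move: tm t0; lra.
rewrite -ltr_sqr ?nnegrE ?distM_ge0//.
apply: (@le_lt_trans _ _ (eucl_dist w q ^+ 2)).
  by rewrite ler_sqr ?nnegrE ?distM_ge0 ?eucl_dist_ge0// distM_le//; exact: proj_in.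
rewrite /distM -/q !eucl_dist_sqr.
have -> : w + t *: v - q = (w - q) + t *: v by rewrite addrAC.
move: (w - q) vq => d vq; rewrite !dotE (dotC d v).
have := dot_ge0 v; nra.
Qed.

(* Let [w] maximize the distance to [M] on the ball of radius [h] around [z]. By
   [distM_ascent], [w - proj w] is a positive multiple of [w - z] and [w] is on
   the sphere, so [z] lies between [w] and [proj w], and [proj w = proj z]. *)
Lemma nearest_extend (rho h : R) z :
  (forall x, distM x < rho -> unique_proj x) ->
  distM z + h < rho -> 0 < h < distM z ->
  nearest (z + (h / distM z) *: (z - proj z)) (proj z).
Proof.
move=> tube zh /andP[h0 hz].
have [w [_ /= zw] wmax] : exists2 w, (setT `&` [set y | eucl_dist z y <= h]) w &
    forall y, eucl_dist z y <= h -> distM y <= distM w.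
  pose B := setT `&` [set y | eucl_dist z y <= h].
  have B0 : B !=set0 by exists z; split=> //=; rewrite eucl_distxx ltW.
  have cB : compact B by exact/compact_eucl_ball/closedT.
  have cd : {within B, continuous distM}.
    exact/continuous_subspaceT/distM_continuous.
  have [w Bw wmax] := EVT_max_rV B0 cB cd.
  exists w; first exact/set_mem.
  by move=> y zy; apply: wmax; apply/mem_set; split.
have dzw : distM z <= distM w by apply: wmax; rewrite eucl_distxx ltW.
have dwz : distM w <= distM z + h.
  by apply: le_trans (distM_lip z w) _; rewrite lerD2l eucl_distC.
set p := proj w; set d := distM w in dzw dwz wmax *.
have [g gE] : exists g, g = w - p by exists (w - p).
have [e eE] : exists e, e = w - z by exists (w - z).
have d0 : 0 < d by apply: lt_le_trans dzw; apply: lt_trans hz.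
have gg : dot g g = d ^+ 2 by rewrite gE -eucl_dist_sqr.
have ee : dot e e <= h ^+ 2.
  by rewrite eE -eucl_dist_sqr eucl_distC ler_sqr ?nnegrE ?eucl_dist_ge0 ?(ltW h0).
have eg : dot e g <= h * d.
  rewrite eE gE; apply: le_trans (dot_le_dist _ _ _ _) _.
  by rewrite -[eucl_dist w p]/d ler_pM2r// eucl_distC.
have {}eg : dot e g = h * d.
  apply/eqP; rewrite eq_le eg/= leNgt; apply/negP => ltg.
  (* Without equality in Cauchy-Schwarz, this direction increases the distance to [M] and, if [w] is
     on the sphere, points into the ball, against the maximality of [w]. *)
  pose v := h *: g - d *: e.
  have hdeg : 0 < d * (h * d - dot e g) by rewrite mulr_gt0// subr_gt0.
  have vg : 0 < dot v g.
    rewrite /v !dotE gg; move: hdeg; rewrite expr2. lra.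
  have uw : unique_proj w by apply: tube; rewrite -/d; lra.
  rewrite gE in vg; have [e1 e10 asc] := distM_ascent uw vg.
  have [|e2 e20 small] := @small_quadratic
    (h ^+ 2 - dot e e) (dot e v) (dot v v) _ (dot_ge0 v).
    have [lth|geh] := ltP (dot e e) (h ^+ 2); first by left; rewrite subr_gt0.
    right; split; first by rewrite subr_ge0.
    rewrite /v !dotE.
    have : 0 <= d * (dot e e - h ^+ 2) by rewrite mulr_ge0 ?(ltW d0)// subr_ge0.
    have : 0 < h * (h * d - dot e g) by rewrite mulr_gt0// subr_gt0.
    by rewrite expr2; lra.
  pose t := Num.min e1 e2 / 2.
  have [t1 t2 t0] : [/\ t < e1, t < e2 & 0 < t].
    have m0 : 0 < Num.min e1 e2 by rewrite lt_min e10.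
    have m1 : Num.min e1 e2 <= e1 by rewrite ge_min lexx.
    have m2 : Num.min e1 e2 <= e2 by rewrite ge_min lexx orbT.
    by rewrite /t; split; lra.
  have : distM (w + t *: v) <= distM w.
    apply: wmax; rewrite -ler_sqr ?nnegrE ?eucl_dist_ge0 ?(ltW h0)//.
    rewrite eucl_distC eucl_dist_sqr.
    have -> : w + t *: v - z = e + t *: v by rewrite eE addrAC.
    have := small t; rewrite t0 t2 => /(_ isT).
    rewrite !(dotDl e) !(dotDr e) !dotZl !dotZr (dotC v e); lra.
  by apply/negP; rewrite -ltNge asc// t0.
have ge : h *: g = d *: e.
  apply/eqP; rewrite -subr_eq0; apply/eqP/dot_eq0/eqP.
  rewrite eq_le dot_ge0 andbT !dotE gg (dotC g e) eg.
  have : 0 <= d ^+ 2 * (h ^+ 2 - dot e e) by rewrite mulr_ge0 ?sqr_ge0// subr_ge0.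
  by rewrite !expr2; lra.
have eg' : e = (h / d) *: g.
  by rewrite mulrC -scalerA ge scalerA mulVf ?gt_eqF// scale1r.
have zp : z - p = (1 - h / d) *: g.
  by rewrite scalerBl scale1r -eg' gE eE opprB [RHS]addrC addrA subrK.
have hd1 : 0 < 1 - h / d.
  by rewrite subr_gt0 ltr_pdivrMr// mul1r; apply: lt_le_trans dzw.
have dzp : eucl_dist z p = d - h.
  rewrite eucl_distE zp !dotE gg mulrA -expr2 -exprMn sqrtr_sqr gtr0_norm ?mulr_gt0//.
  by rewrite mulrBl mul1r divfK// gt_eqF.
have Mp : M p by exact: proj_in.
(* The distance from [z] to [p] is [d - h], at most [distM z], so [p] is nearest to [z] as well. *)
have pz : p = proj z.
  apply: tube; first lra.
  split=> // y My; apply: le_trans (distM_le _ My); rewrite dzp; lra.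
have dE : d = distM z + h by rewrite /distM -pz dzp subrK.
rewrite -pz zp scalerA.
have -> : h / distM z * (1 - h / d) = h / d.
  by rewrite dE; field; rewrite -dE !gt_eqF//=; apply: lt_trans hz.
rewrite -eg' eE addrCA subrr addr0.
exact: proj_nearest.
Qed.

(* Federer, Curvature measures, Theorem 4.8 (7). *)
Lemma nearest_ray (rho : R) x y :
  (forall x, distM x < rho -> unique_proj x) ->
  distM x < rho -> M y ->
  2 * rho * dot (x - proj x) (y - proj x)
    <= distM x * eucl_dist y (proj x) ^+ 2.
Proof.
move=> tube xrho My; set p := proj x; set r := distM x.
have [g gE] : exists g, g = x - p by exists (x - p).
rewrite -gE.
have r0 : 0 <= r by exact: distM_ge0.
have [r_eq0|r_neq0] := eqVneq r 0.
  have -> : g = 0 by apply/eqP; rewrite gE subr_eq0; apply/eqP/eucl_dist_eq0.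
  by rewrite dot0l mulr0 mulr_ge0// sqr_ge0.
have {r_neq0}r0 : 0 < r by rewrite lt_def r_neq0.
have gg : dot g g = r ^+ 2 by rewrite gE -eucl_dist_sqr.
(* By [QP], for [s >= 0] this says that [p] is a nearest point of the point at distance [s] from [p]
   on the ray through [x]. For each [y] it is linear in [s], so it passes to suprema. *)
pose Q s := forall y, M y -> 2 * s * dot g (y - p) <= r * eucl_dist y p ^+ 2.
have Mp : M p by exact: proj_in.
have QP s : 0 <= s -> Q s <-> nearest (p + (s / r) *: g) p.
  move=> s0.
  have E c : r * (eucl_dist (p + (s / r) *: g) c ^+ 2
                  - eucl_dist (p + (s / r) *: g) p ^+ 2)
    = r * eucl_dist c p ^+ 2 - 2 * s * dot g (c - p).
    rewrite !eucl_dist_sqr.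
    have -> : p + (s / r) *: g - p = (s / r) *: g by rewrite addrC addKr.
    have -> : p + (s / r) *: g - c = (s / r) *: g - (c - p).
      by rewrite opprB addrCA addrA.
    move: (c - p) => d; rewrite !dotE gg (dotC d g).
    by field; rewrite gt_eqF.
  split=> [Qs|[_ pmin] z Mz].
    split=> // z Mz; rewrite -ler_sqr ?nnegrE ?eucl_dist_ge0// -subr_ge0.
    by rewrite -(pmulr_rge0 _ r0) E subr_ge0 Qs.
  rewrite -subr_ge0 -E pmulr_rge0// subr_ge0 ler_sqr ?nnegrE ?eucl_dist_ge0//.
  exact: pmin.
have Qr : Q r.
  apply/QP => //; first exact: ltW.
  by rewrite divff ?gt_eqF// scale1r gE addrC subrK; exact: proj_nearest.
have mono s1 s2 : 0 <= s1 <= s2 -> Q s2 -> Q s1.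
  move=> /andP[s10 s12] Q2 z Mz; have := Q2 z Mz.
  have := mulr_ge0 (ltW r0) (sqr_ge0 (eucl_dist z p)).
  have [a0|a0] := leP (dot g (z - p)) 0.
    by have := mulr_ge0_le0 s10 a0; lra.
  by have := ler_wpM2r (ltW a0) s12; lra.
have rho0 : 0 < rho by exact: lt_trans xrho.
(* Continuation along the ray: were [Q] to fail before [rho], it would still hold at the supremum
   [S] of the good parameters, and [nearest_extend] would carry it beyond [S]. *)
have Qall s : 0 <= s -> s < rho -> Q s.
  move=> s0 srho; apply: contrapT => nQs.
  pose E := [set s | 0 <= s /\ Q s].
  have ubE : ubound E s.
    move=> s' [s'0 Qs']; rewrite leNgt; apply/negP => ss'.
    by apply: nQs; apply: mono Qs'; rewrite s0 ltW.
  have supE : has_sup E by split; [exists r; split=> //; exact: ltW|exists s].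
  have rS : r <= sup E by apply: sup_upper_bound => //; split=> //; exact: ltW.
  have Ss : sup E <= s by apply: ge_sup => //; exists r; split=> //; exact: ltW.
  set S := sup E in rS Ss *.
  have S0 : 0 < S by exact: lt_le_trans rS.
  have QS : Q S.
    move=> z Mz; have [g0|g0] := leP (dot g (z - p)) 0.
      have := mulr_ge0 (ltW r0) (sqr_ge0 (eucl_dist z p)).
      by have := mulr_ge0_le0 (ltW S0) g0; lra.
    have : S <= r * eucl_dist z p ^+ 2 / (2 * dot g (z - p)).
      apply: ge_sup; first by exists r; split=> //; exact: ltW.
      move=> s' [_ /(_ z Mz)]; rewrite ler_pdivlMr ?mulr_gt0//; lra.
    by rewrite ler_pdivlMr ?mulr_gt0//; lra.
  pose z := p + (S / r) *: g.
  have nz : nearest z p by apply/QP => //; exact: ltW.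
  have dz : distM z = S.
    rewrite -(distM_nearest nz) eucl_distE /z addrAC subrr add0r !dotE gg.
    by rewrite mulrA -expr2 -exprMn divfK ?gt_eqF// sqrtr_sqr gtr0_norm.
  have pz : p = proj z by apply: tube => //; rewrite dz; exact: le_lt_trans srho.
  pose h := Num.min S (rho - S) / 2.
  have [h0 hS hrho] : [/\ 0 < h, h < S & S + h < rho].
    have m0 : 0 < Num.min S (rho - S) by rewrite lt_min S0; lra.
    have m1 : Num.min S (rho - S) <= S by rewrite ge_min lexx.
    have m2 : Num.min S (rho - S) <= rho - S by rewrite ge_min lexx orbT.
    by rewrite /h; split; lra.
  have := @nearest_extend rho h z tube; rewrite dz h0 hS -pz => /(_ hrho isT).
  have -> : z + (h / S) *: (z - p) = p + ((S + h) / r) *: g.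
    have -> : z - p = (S / r) *: g by rewrite /z addrC addKr.
    rewrite /z scalerA -addrA -scalerDl.
    by congr (_ + _ *: _); field; rewrite !gt_eqF.
  move=> /QP QSh; suff : S + h <= S by lra.
  apply: sup_upper_bound => //; split; first lra.
  by apply: QSh; lra.
have [g0|g0] := leP (dot g (y - p)) 0.
  have := mulr_ge0 (ltW r0) (sqr_ge0 (eucl_dist y p)).
  by have := mulr_ge0_le0 (ltW rho0) g0; lra.
rewrite leNgt; apply/negP => lt_rho.
set B := r * _ in lt_rho.
have B0 : 0 <= B by rewrite mulr_ge0 ?sqr_ge0// ltW.
(* If the inequality fails at [rho], it fails at every parameter above [b], hence at the midpoint of
   [b] and [rho]. *)
pose b := B / (2 * dot g (y - p)).
have b0 : 0 <= b by rewrite divr_ge0// mulr_ge0// ltW.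
have b1 : b < rho by rewrite ltr_pdivrMr ?mulr_gt0//; lra.
have : Q ((b + rho) / 2) by apply: Qall; lra.
move=> /(_ y My); rewrite -/B.
have : b * (2 * dot g (y - p)) = B by rewrite divfK// gt_eqF// mulr_gt0.
nra.
Qed.

End NearestPoint.

(** * Barycenters and Jung's theorem *)

Section Barycenter.
Variables (R : realType) (n : nat).
Local Notation V := 'rV[R]_n.

(** The points, completed by a coordinate 1, are the rows of a matrix with [n + 1] columns, hence
    linearly dependent; the sign is chosen to make some coefficient positive. *)
Lemma affine_dependence (s : seq V) : (n.+1 < size s)%N -> uniq s ->
  exists a : V -> R, [/\ \sum_(v <- s) a v = 0, \sum_(v <- s) a v *: v = 0
    & exists2 v, v \in s & 0 < a v].
Proof.
move=> ss us; pose m := size s.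
pose A : 'M[R]_(m, n + 1) := \matrix_(i < m) row_mx (s`_i) (const_mx 1).
have : kermx A != 0.
  rewrite -mxrank_eq0 mxrank_ker subn_eq0 -ltnNge.
  by apply: leq_ltn_trans (rank_leq_col _) _; rewrite addn1.
case/rowV0Pn => u /sub_kermxP uA u0.
have {u u0 uA} [u uA [i0 ui0]] : exists2 u : 'rV[R]_m, u *m A = 0 &
    exists i, 0 < u 0 i.
  have [i ui] : exists i, u 0 i != 0 by exact/rV0Pn.
  have [ui'|ui'] := ltP 0 (u 0 i); first by exists u => //; exists i.
  exists (- u); first by rewrite mulNmx uA oppr0.
  by exists i; rewrite mxE oppr_gt0 lt_neqAle ui.
have uE : u *m A = row_mx (\sum_i u 0 i *: s`_i) (const_mx (\sum_i u 0 i)).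
  rewrite mulmx_sum_row; apply/rowP => j; rewrite summxE.
  case: (splitP j) => k jk.
    have -> : j = lshift 1 k by exact: val_inj.
    rewrite row_mxEl summxE; apply: eq_bigr => i _.
    by rewrite rowK mxE row_mxEl [RHS]mxE.
  have -> : j = rshift n k by exact: val_inj.
  rewrite row_mxEr mxE; apply: eq_bigr => i _.
  by rewrite rowK mxE row_mxEr mxE mulr1.
pose a v := \sum_(i < m | s`_i == v) u 0 i.
have aE (i : 'I_m) : a s`_i = u 0 i.
  rewrite /a (eq_bigl (pred1 i)) ?big_pred1_eq// => j /=.
  by rewrite nth_uniq.
move: uE; rewrite uA -[0]hsubmxK => /eq_row_mx[].
rewrite !linear0 => e1 e2; exists a; split.
- rewrite (big_nth 0) big_mkord; under eq_bigr do rewrite aE.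
  by move/rowP/(_ 0): e2; rewrite !mxE.
- by rewrite (big_nth 0) big_mkord; under eq_bigr do rewrite aE.
- by exists s`_i0; rewrite ?mem_nth// aE.
Qed.

Definition weights (s : seq V) (t : V -> R) : Prop :=
  [/\ uniq s, forall v, v \in s -> 0 <= t v & \sum_(v <- s) t v = 1].

(** As long as there are more than [n + 1] points, a multiple of an affine dependence is subtracted
    from the weights. The vertex with the smallest ratio [t v / a v] loses its weight while the
    others stay nonnegative. *)
Lemma caratheodory (s : seq V) (t : V -> R) : weights s t ->
  exists s' t', [/\ weights s' t', {subset s' <= s}, (size s' <= n.+1)%N
    & \sum_(v <- s') t' v *: v = \sum_(v <- s) t v *: v].
Proof.
have [k] := ubnP (size s); elim: k => // k IH in s t *; rewrite ltnS => sk wst.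
have [small|big] := leqP (size s) n.+1; first by exists s, t; split.
have [us t0 t1] := wst.
have [a [a1 a2 [v1 v1s av1]]] := affine_dependence big us.
have [v0 [v0s av0] v0min] : exists2 v0, v0 \in s /\ 0 < a v0 &
    forall v, v \in s -> 0 < a v -> t v0 / a v0 <= t v / a v.
  have i1 : (index v1 s < size s)%N by rewrite index_mem.
  have := @arg_minP _ _ _ (Ordinal i1) (fun i : 'I_(size s) => 0 < a s`_i)
    (fun i => t s`_i / a s`_i).
  rewrite /= nth_index// => /(_ av1)[i ai imin].
  exists s`_i; first by rewrite mem_nth.
  move=> v vs av; have iv : (index v s < size s)%N by rewrite index_mem.
  by have := imin (Ordinal iv); rewrite /= nth_index//; apply.
pose l := t v0 / a v0.
pose t' v := t v - l * a v.
have l0 : 0 <= l by rewrite divr_ge0 ?t0// ltW.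
have t'0 : t' v0 = 0 by rewrite /t' /l divfK ?subrr// gt_eqF.
(* One identity for both invariants: with [c] constant 1 it gives the total weight, with [c] the
   identity the barycenter. *)
have S (W : lmodType R) (c : V -> W) :
    \sum_(v <- rem v0 s) t' v *: c v =
    \sum_(v <- s) t v *: c v - l *: \sum_(v <- s) a v *: c v.
  rewrite scaler_sumr -sumrB (perm_big _ (perm_to_rem v0s))/= big_cons.
  rewrite -[X in _ = X + _]/(t v0 *: c v0 - l *: (a v0 *: c v0)) scalerA -scalerBl.
  rewrite -/(t' v0) t'0 scale0r add0r; apply: eq_bigr => v _.
  by rewrite scalerA -scalerBl.
have [||s' [t'' [w' ss' sz e]]] := IH (rem v0 s) t'.
- by rewrite size_rem//; case: (s) v0s sk.
- split; first exact: rem_uniq.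
    move=> v /mem_rem vs; rewrite /t' subr_ge0.
    have [av|av] := ltP 0 (a v); first by rewrite -ler_pdivlMr// v0min.
    by apply: le_trans (t0 _ vs); rewrite mulr_ge0_le0.
  have S1 (s1 : seq V) (b : V -> R) :
      \sum_(v <- s1) b v *: (1 : R^o) = \sum_(v <- s1) b v.
    by apply: eq_bigr => v _; exact: mulr1.
  by have := S R^o (fun=> 1); rewrite !S1 a1 scaler0 subr0 t1.
exists s', t''; split=> //; first by move=> v /ss' /mem_rem.
by rewrite e (S _ id) a2 scaler0 subr0.
Qed.

(** The parallel axis identity: the cross terms [dot (y - x) (x - v)] have weighted mean 0 because
    [x] is the barycenter. *)
Lemma barycenter_sqdist (s : seq V) (t : V -> R) (y : V) :
  weights s t -> let x := \sum_(v <- s) t v *: v in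
  \sum_(v <- s) t v * eucl_dist y v ^+ 2 =
  eucl_dist y x ^+ 2 + \sum_(v <- s) t v * eucl_dist x v ^+ 2.
Proof.
move=> [us t0 t1] x.
have -> : eucl_dist y x ^+ 2 = \sum_(v <- s) t v * eucl_dist y x ^+ 2.
  by rewrite -mulr_suml t1 mul1r.
have dx0 : \sum_(v <- s) t v * dot (y - x) (x - v) = 0.
  under eq_bigr do rewrite -dotZr; rewrite -dot_sumr.
  have -> : \sum_(v <- s) t v *: (x - v) = 0; last by rewrite dotC dot0l.
  under eq_bigr do rewrite scalerBr.
  by rewrite sumrB -scaler_suml t1 scale1r subrr.
have {}dx0 : \sum_(v <- s) 2 * (t v * dot (y - x) (x - v)) = 0.
  by rewrite -mulr_sumr dx0 mulr0.
rewrite -[RHS]addr0 -[X in _ = _ + X]dx0 -!big_split/=.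
apply: eq_bigr => v _; rewrite !eucl_dist_sqr.
have -> : y - v = (y - x) + (x - v) by rewrite addrA subrK.
move: (y - x) (x - v) => a b; rewrite !dotE (dotC b a); ring.
Qed.

Lemma jung_ge0 : 0 <= jung R n. Proof. exact: sqrtr_ge0. Qed.

Lemma jung_sqr : jung R n ^+ 2 = n%:R / (2 * n.+1%:R).
Proof. by rewrite sqr_sqrtr// divr_ge0// mulr_ge0. Qed.

(** After reduction to at most [n + 1] vertices, let [q] be the mean squared distance to the
    barycenter. Averaging the parallel axis identity over [y] gives [2 * q] as the mean of the
    squared mutual distances, at most [d ^+ 2] times 1 minus the sum of the squared weights; some
    vertex does no worse than the mean. *)
Lemma jung_vertex (s : seq V) (t : V -> R) (d : R) :
  weights s t -> 0 <= d -> {in s &, forall v w, eucl_dist v w <= d} ->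
  exists2 v, v \in s & eucl_dist (\sum_(v <- s) t v *: v) v <= jung R n * d.
Proof.
move=> wst d0 sd; set x := \sum_(v <- s) _.
have [s' [t' [w' s's sz xE]]] := caratheodory wst.
have [us' t'0 t'1] := w'.
pose q := \sum_(v <- s') t' v * eucl_dist x v ^+ 2.
have qle : q <= (jung R n * d) ^+ 2.
  have q2 : \sum_(w <- s') t' w * \sum_(v <- s') t' v * eucl_dist w v ^+ 2 = q + q.
    under eq_bigr do rewrite (barycenter_sqdist _ w') xE -/x mulrDr.
    rewrite big_split/= -mulr_suml t'1 mul1r; congr (_ + _).
    by apply: eq_bigr => v _; rewrite eucl_distC.
  pose c : R := n.+1%:R^-1.
  (* From the squared deviations of the weights from [c], since there are at most [n + 1] of
     them. *)
  have t2 : c <= \sum_(v <- s') t' v ^+ 2.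
    have : 0 <= \sum_(v <- s') (t' v - c) ^+ 2 by apply: sumr_ge0 => v _; exact: sqr_ge0.
    have -> : \sum_(v <- s') (t' v - c) ^+ 2 =
        \sum_(v <- s') t' v ^+ 2 - 2 * c + (size s')%:R * c ^+ 2.
      have -> : 2 * c = \sum_(v <- s') 2 * c * t' v by rewrite -mulr_sumr t'1 mulr1.
      have -> : (size s')%:R * c ^+ 2 = \sum_(v <- s') c ^+ 2.
        by rewrite big_const_seq count_predT iter_addr_0 mulr_natl.
      by rewrite -sumrB -big_split; apply: eq_bigr => v _ /=; ring.
    have : (size s')%:R * c ^+ 2 <= c.
      apply: (@le_trans _ _ (n.+1%:R * c ^+ 2)).
        by rewrite ler_wpM2r ?sqr_ge0// ler_nat.
      by rewrite expr2 mulrA mulfV// mul1r.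
    lra.
  have : q + q <= d ^+ 2 * (1 - \sum_(v <- s') t' v ^+ 2).
    have -> : d ^+ 2 * (1 - \sum_(v <- s') t' v ^+ 2) =
        \sum_(w <- s') t' w * (d ^+ 2 * (1 - t' w)).
      rewrite mulrBr mulr1 mulr_sumr.
      have {1}-> : d ^+ 2 = \sum_(w <- s') d ^+ 2 * t' w by rewrite -mulr_sumr t'1 mulr1.
      by rewrite -sumrB; apply: eq_bigr => w _; ring.
    rewrite -q2 big_seq [leRHS]big_seq; apply: ler_sum => w ws.
    rewrite (bigD1_seq w)//= eucl_distxx expr0n mulr0 add0r.
    apply: ler_wpM2l; first exact: t'0.
    have -> : 1 - t' w = \sum_(v <- s' | v != w) t' v.
      by rewrite -t'1 (bigD1_seq w)//= addrAC subrr add0r.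
    rewrite mulr_sumr big_seq_cond [leRHS]big_seq_cond.
    apply: ler_sum => v /andP[vs _]; rewrite mulrC; apply: ler_wpM2r; first exact: t'0.
    by rewrite ler_sqr ?nnegrE ?eucl_dist_ge0// sd// s's.
  have : d ^+ 2 * c <= d ^+ 2 * \sum_(v <- s') t' v ^+ 2 by rewrite ler_wpM2l ?sqr_ge0.
  rewrite exprMn jung_sqr.
  have -> : n%:R / (2 * n.+1%:R) = (1 - c) / 2 :> R.
    rewrite /c -natr1; have n0 : 0 <= n%:R :> R by []. field.
    by apply: lt0r_neq0; lra.
  lra.
have [v vs' vx] : exists2 v, v \in s' & eucl_dist x v <= jung R n * d.
  apply: contrapT => nv.
  suff : (jung R n * d) ^+ 2 < q by rewrite ltNge qle.
  have lt v : v \in s' -> (jung R n * d) ^+ 2 < eucl_dist x v ^+ 2.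
    move=> vs'; rewrite ltr_sqr ?nnegrE ?mulr_ge0 ?jung_ge0 ?eucl_dist_ge0//.
    by rewrite ltNge; apply/negP => le; apply: nv; exists v.
  have [v0 v0s tv0] : exists2 v, v \in s' & 0 < t' v.
    apply: contrapT => nt; move: t'1; rewrite big_seq big1 => [/eqP|v vs].
      by rewrite eq_sym oner_eq0.
    apply/eqP; rewrite eq_le t'0// andbT leNgt; apply/negP => tv.
    by apply: nt; exists v.
  rewrite -[ltLHS]mul1r -t'1 mulr_suml /q (bigD1_seq v0)//= [ltRHS](bigD1_seq v0)//=.
  apply: ltr_leD; first by rewrite ltr_pM2l// lt.
  rewrite big_seq_cond [leRHS]big_seq_cond; apply: ler_sum => v /andP[vs _].
  by apply: ler_wpM2l; [exact: t'0|exact/ltW/lt].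
by exists v => //; exact: s's.
Qed.

End Barycenter.

(** * Barycentric coordinates on Rips complexes *)

Lemma not_pos0 (R : realDomainType) (T : Type) (t : T -> R) :
  (forall v, 0 <= t v) -> forall v, ~~ (0 < t v) -> t v = 0.
Proof. by move=> t0 v; rewrite -leNgt => tv; apply/eqP; rewrite eq_le tv t0. Qed.

Section RipsPoints.
Variables (R : realType) (n : nat) (delta : R).
Local Notation V := 'rV[R]_n.
Implicit Types (t a : V -> R) (X : set V).

Definition finsupp t : Prop := exists F : {fset V}, forall v, v \notin F -> t v = 0.

(** Points of the realization as bare coordinate functions: one function can be a point at several
    levels, without any transport between types. *)
Definition rips_point X t : Prop :=
  [/\ forall v, 0 <= t v, finsupp t, \sum_(v \in [set: V]) t v = 1,
      forall v, 0 < t v -> X v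
    & forall v w, 0 < t v -> 0 < t w -> eucl_dist v w < delta].

Lemma finsupp_pos t : (forall v, 0 <= t v) -> finsupp t ->
  exists s : {fset V}, forall v, (v \in s) = (0 < t v).
Proof.
move=> t0 [F tF]; exists [fset v in F | 0 < t v]%fset => v.
rewrite !inE/=; have [//|/tF ->] := boolP (v \in F).
by rewrite ltxx.
Qed.

Lemma rips_point_weights X t : rips_point X t ->
  exists s : {fset V}, [/\ forall v, (v \in s) = (0 < t v), weights s t
    & forall v, v \notin s -> t v = 0].
Proof.
move=> [t0 ft t1 _ _]; have [s sE] := finsupp_pos t0 ft.
have ts v : v \notin s -> t v = 0 by rewrite sE; exact: not_pos0.
exists s; split=> //; split=> //; first exact: fset_uniq.
by rewrite -t1 (fsbigTE s).
Qed.

Lemma rips_point_georeal X (t : georeal R (rips (@eucl_dist R n) delta X)) :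
  rips_point X t.
Proof.
have [s [s0 sX sd] [st s1]] := bary_simplex t.
have ts v : 0 < t v -> v \in s.
  by apply: contraTT => /st ->; rewrite ltxx.
split.
- exact: bary_ge0.
- by exists s.
- by rewrite (fsbigTE s).
- by move=> v /ts /sX.
- by move=> v w /ts vs /ts ws; exact: sd.
Qed.

Definition georeal_of X t (Xt : rips_point X t) :
  georeal R (rips (@eucl_dist R n) delta X).
Proof.
exists t; first by case: Xt.
have [s [sE [us t0 t1] st]] := rips_point_weights Xt; exists s => //.
have [_ _ _ tX td] := Xt; split.
- apply/negP => /eqP s0; move: t1; rewrite s0 big_seq_fset0 => /eqP.
  by rewrite eq_sym oner_eq0.
- by move=> v; rewrite sE => /tX.
- by move=> v w; rewrite !sE => ? ?; exact: td.
Defined.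

Lemma georeal_ext X (t t' : georeal R (rips (@eucl_dist R n) delta X)) :
  bary t =1 bary t' -> t = t'.
Proof.
case: t t' => [t a b] [t' a' b'] /= /funext tt'; subst t'.
by congr Georeal; exact: Prop_irrelevance.
Qed.

Lemma rips_pointS X Y t : X `<=` Y -> rips_point X t -> rips_point Y t.
Proof. by move=> XY [? ? ? tX ?]; split=> // v /tX /XY. Qed.

Lemma rips_point_pos X t : rips_point X t -> exists v, 0 < t v.
Proof.
move=> [t0 _ t1 _ _]; have : 0 < \sum_(v \in [set: V]) t v by rewrite t1.
by move=> /(fsumr_gt0 [::])[v _ tv]; exists v.
Qed.

Lemma fsbigD (f g : V -> R) : finsupp f -> finsupp g ->
  \sum_(v \in [set: V]) (f v + g v) =
  \sum_(v \in [set: V]) f v + \sum_(v \in [set: V]) g v.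
Proof.
move=> [F fF] [G gG]; have FG v : v \notin (F `|` G)%fset -> f v = 0 /\ g v = 0.
  by rewrite inE negb_or => /andP[/fF -> /gG ->].
rewrite !(fsbigTE (F `|` G)%fset) ?big_split//.
- by move=> v /FG[].
- by move=> v /FG[].
- by move=> v /FG[-> ->]; rewrite addr0.
Qed.

Lemma finsuppZ k t : finsupp t -> finsupp (fun v => k * t v).
Proof. by move=> [F tF]; exists F => v /tF ->; rewrite mulr0. Qed.

Lemma finsuppD a t : finsupp a -> finsupp t -> finsupp (fun v => a v + t v).
Proof.
move=> [F aF] [G tG]; exists (F `|` G)%fset => v.
by rewrite inE negb_or => /andP[/aF -> /tG ->]; rewrite addr0.
Qed.

(** The last hypothesis makes the union of the two supports a simplex, which contains the
    segment. *)
Lemma rips_point_segment X t t' r : 0 <= r <= 1 ->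
  rips_point X t -> rips_point X t' ->
  (forall v w, 0 < t v -> 0 < t' w -> eucl_dist v w < delta) ->
  rips_point X (fun v => (1 - r) * t v + r * t' v).
Proof.
move=> /andP[r0 r1] [t0 ft t1 tX td] [t0' ft' t1' tX' td'] tt'.
have r10 : 0 <= 1 - r by rewrite subr_ge0.
have pos v : 0 < (1 - r) * t v + r * t' v -> 0 < t v \/ 0 < t' v.
  move=> p; have [?|/negP/(not_pos0 t0) tv] := pselect (0 < t v); first by left.
  have [?|/negP/(not_pos0 t0') tv'] := pselect (0 < t' v); first by right.
  by move: p; rewrite tv tv' !mulr0 addr0 ltxx.
split.
- by move=> v; rewrite addr_ge0 ?mulr_ge0.
- by apply: finsuppD; exact: finsuppZ.
- rewrite fsbigD; [|exact: finsuppZ..].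
  by rewrite -!mulr_fsumr t1 t1' !mulr1 subrK.
- by move=> v /pos[/tX|/tX'].
- move=> v w /pos[] tv /pos[] tw; [exact: td|exact: tt'| |exact: td'].
  by rewrite eucl_distC; exact: tt'.
Qed.

Lemma fsbig_gt0 a : (forall v, 0 <= a v) -> finsupp a -> (exists v, 0 < a v) ->
  0 < \sum_(v \in [set: V]) a v.
Proof.
move=> a0 [F aF] [v av].
have vF : v \in F by apply: contraTT av => /aF ->; rewrite ltxx.
by rewrite (fsbigTE F)// (big_fsetD1 v)//= ltr_pwDl// sumr_ge0.
Qed.

Lemma normalize_gt0 a v : (forall v, 0 <= a v) -> 0 < normalize a v -> 0 < a v.
Proof.
move=> a0; apply: contraTT => /(not_pos0 a0) av.
by rewrite /normalize av mul0r ltxx.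
Qed.

Lemma rips_point_normalize X a :
  (forall v, 0 <= a v) -> finsupp a -> (exists v, 0 < a v) ->
  (forall v, 0 < a v -> X v) ->
  (forall v w, 0 < a v -> 0 < a w -> eucl_dist v w < delta) ->
  rips_point X (normalize a).
Proof.
move=> a0 fa pa aX ad; have S0 := fsbig_gt0 a0 fa pa.
have -> : normalize a = (fun v => (\sum_(w \in [set: V]) a w)^-1 * a v).
  by apply/funext => v; rewrite /normalize mulrC.
split.
- by move=> v; rewrite mulr_ge0// invr_ge0 ltW.
- exact: finsuppZ.
- by rewrite -mulr_fsumr mulVf// gt_eqF.
- by move=> v; rewrite pmulr_rgt0 ?invr_gt0//; exact: aX.
- by move=> v w; rewrite !pmulr_rgt0 ?invr_gt0//; exact: ad.
Qed.

(** Half the mean of the coordinates weighted by themselves: a continuous positive threshold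
    strictly below the largest coordinate. *)
Definition level t : R := (\sum_(v \in [set: V]) t v ^+ 2) / 2.

(** Coordinates are lowered by the threshold before being cut, so they vanish continuously. *)
Definition trunc t : V -> R := fun v => Num.max 0 (t v - level t).

Definition theta t : V -> R := normalize (trunc t).

Lemma finsupp_sqr t : finsupp t -> finsupp (fun v => t v ^+ 2).
Proof. by move=> [F tF]; exists F => v /tF ->; rewrite expr0n. Qed.

Lemma level_ge0 t : 0 <= level t.
Proof. by rewrite divr_ge0// fsumr_ge0// => v _; exact: sqr_ge0. Qed.

Lemma level_gt0 X t : rips_point X t -> 0 < level t.
Proof.
move=> Xt; have [v tv] := rips_point_pos Xt; have [t0 ft _ _ _] := Xt.
rewrite divr_gt0// fsbig_gt0//; first by move=> w; exact: sqr_ge0.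
  exact: finsupp_sqr.
by exists v; rewrite exprn_gt0.
Qed.

Lemma trunc_ge0 t v : 0 <= trunc t v.
Proof. by rewrite /trunc le_max lexx. Qed.

Lemma trunc_gt0 t v : (0 < trunc t v) = (level t < t v).
Proof. by rewrite /trunc lt_max ltxx subr_gt0. Qed.

(** If no coordinate exceeded [level t], the sum of squares, which is [2 * level t], would be at
    most [level t]. *)
Lemma level_lt X t : rips_point X t -> exists v, level t < t v.
Proof.
move=> Xt; apply: contrapT => nlt; have l0 := level_gt0 Xt.
have [s [sE [us t0 t1] st]] := rips_point_weights Xt.
have tl v : t v <= level t by rewrite leNgt; apply/negP => ?; apply: nlt; exists v.
have : 2 * level t <= level t.
  rewrite {1}/level mulrC divfK// (fsbigTE s); last by move=> v /st ->; rewrite expr0n.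
  rewrite -[leRHS]mulr1 -t1 mulr_sumr big_seq [leRHS]big_seq.
  apply: ler_sum => v vs; rewrite expr2; apply: ler_wpM2r => //.
  exact: t0.
by lra.
Qed.

Lemma level_le1 X t : rips_point X t -> level t <= 1.
Proof.
move=> Xt; have [v lt] := level_lt Xt; apply: le_trans (ltW lt) _.
have [s [sE [us t0 t1] st]] := rips_point_weights Xt.
have vs : v \in s by rewrite sE; apply: le_lt_trans lt; exact: level_ge0.
rewrite -t1 (big_fsetD1 v)//= lerDl big_seq sumr_ge0// => w.
by rewrite !inE => /andP[_ /t0].
Qed.

Lemma theta_gt0 t v : 0 < theta t v -> level t < t v.
Proof. by move=> /(normalize_gt0 (trunc_ge0 t)); rewrite trunc_gt0. Qed.

Lemma theta_gt0_le t v : 0 < theta t v -> 0 < t v.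
Proof. by move=> /theta_gt0; apply: le_lt_trans; exact: level_ge0. Qed.

Lemma finsupp_trunc t : finsupp t -> finsupp (trunc t).
Proof.
move=> [F tF]; exists F => v /tF tv; apply: (not_pos0 (trunc_ge0 t)).
by rewrite trunc_gt0 tv -leNgt level_ge0.
Qed.

Lemma rips_point_theta X t : rips_point X t -> rips_point X (theta t).
Proof.
move=> Xt; have [t0 ft _ tX td] := Xt.
have pos v : 0 < trunc t v -> 0 < t v.
  by rewrite trunc_gt0; apply: le_lt_trans; exact: level_ge0.
apply: rips_point_normalize.
- exact: trunc_ge0.
- exact: finsupp_trunc.
- by have [v lt] := level_lt Xt; exists v; rewrite trunc_gt0.
- by move=> v /pos /tX.
- by move=> v w /pos tv /pos; exact: td.
Qed.

Lemma rips_point_theta_segment X t r : 0 <= r <= 1 -> rips_point X t ->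
  rips_point X (fun v => (1 - r) * t v + r * theta t v).
Proof.
move=> r01 Xt; apply: rips_point_segment => //; first exact: rips_point_theta.
by move=> v w tv /theta_gt0_le; have [_ _ _ _] := Xt; apply.
Qed.

(** Large when two vertices of substantial weight are at distance close to [delta]. The weights
    cancel the terms off the support, where the denominator need not be positive. *)
Definition energy t : R :=
  \sum_(v \in [set: V]) \sum_(w \in [set: V]) t v * t w / (delta - eucl_dist v w).

(* A continuous lower bound for the distance to [delta] of the diameter of the
   support of [theta t]; the latter is only semicontinuous in [t]. *)
Definition gap t : R := level t ^+ 2 / (2 / delta + energy t).

Hypothesis delta0 : 0 < delta.

Lemma energy_term_ge0 X t v w : rips_point X t ->
  0 <= t v * t w / (delta - eucl_dist v w).
Proof.
move=> [t0 _ _ _ td].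
have [tv|/(not_pos0 t0) ->] := boolP (0 < t v); last by rewrite !mul0r.
have [tw|/(not_pos0 t0) ->] := boolP (0 < t w); last by rewrite mulr0 mul0r.
by rewrite divr_ge0 ?mulr_ge0// subr_ge0 ltW// td.
Qed.

Lemma energy_ge0 X t : rips_point X t -> 0 <= energy t.
Proof.
move=> Xt; apply: fsumr_ge0 => v _; apply: fsumr_ge0 => w _.
exact: energy_term_ge0 Xt.
Qed.

Lemma energy_term_le X t v w : rips_point X t -> 0 < t v -> 0 < t w ->
  t v * t w / (delta - eucl_dist v w) <= energy t.
Proof.
move=> Xt tv tw; have [s [sE _ st]] := rips_point_weights Xt.
have inner v' : \sum_(w \in [set: V]) t v' * t w / (delta - eucl_dist v' w) =
    \sum_(w <- s) t v' * t w / (delta - eucl_dist v' w).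
  by rewrite (fsbigTE s)// => w' /st ->; rewrite mulr0 mul0r.
rewrite /energy (fsbigTE s); last first.
  move=> v' /st tv'; rewrite inner big1// => w' _.
  by rewrite tv' !mul0r.
have [vs ws] : v \in s /\ w \in s by rewrite !sE.
rewrite (big_fsetD1 v)//= inner (big_fsetD1 w)//= -addrA lerDl addr_ge0//.
  by apply: sumr_ge0 => w' _; exact: energy_term_ge0 Xt.
apply: sumr_ge0 => v' _; rewrite inner; apply: sumr_ge0 => w' _.
exact: energy_term_ge0 Xt.
Qed.

Lemma gap_denom_gt0 X t : rips_point X t -> 0 < 2 / delta + energy t.
Proof. by move=> /energy_ge0 e0; rewrite ltr_pwDl// divr_gt0. Qed.

Lemma gap_gt0 X t : rips_point X t -> 0 < gap t.
Proof.
move=> Xt; rewrite divr_gt0 ?(gap_denom_gt0 Xt)//.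
by rewrite exprn_gt0// (level_gt0 Xt).
Qed.

(** The reason for the summand [2 / delta] in [gap]: points within [delta / 2] of a common point
    span a simplex. *)
Lemma gap_le_half X t : rips_point X t -> gap t <= delta / 2.
Proof.
move=> Xt; rewrite ler_pdivrMr ?(gap_denom_gt0 Xt)//.
have l1 : level t ^+ 2 <= 1 by rewrite expr_le1 ?level_ge0 ?(level_le1 Xt).
apply: le_trans l1 _; rewrite mulrDr.
have -> : delta / 2 * (2 / delta) = 1 by field; rewrite gt_eqF.
by rewrite lerDl mulr_ge0 ?(energy_ge0 Xt)// divr_ge0 ?ltW.
Qed.

(** Both vertices have coordinates above [level t], so their single term in the energy is already at
    least [level t ^+ 2 / (delta - eucl_dist v w)]. *)
Lemma gap_le X t v w : rips_point X t -> 0 < theta t v -> 0 < theta t w ->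
  eucl_dist v w <= delta - gap t.
Proof.
move=> Xt tv tw; have [lv lw] := (theta_gt0 tv, theta_gt0 tw).
have {}tv := theta_gt0_le tv; have {}tw := theta_gt0_le tw.
have dvw : 0 < delta - eucl_dist v w by rewrite subr_gt0; have [_ _ _ _] := Xt; apply.
rewrite lerBrDr -lerBrDl; set d := delta - _ in dvw *.
rewrite ler_pdivrMr ?(gap_denom_gt0 Xt)//.
apply: (@le_trans _ _ (d * energy t)); last first.
  by rewrite ler_pM2l// lerDr divr_ge0// ltW.
rewrite mulrC -ler_pdivrMr//; apply: le_trans (energy_term_le Xt tv tw).
rewrite ler_pM2r ?invr_gt0// expr2; apply: ler_pM; rewrite ?level_ge0//; exact: ltW.
Qed.

(** * Continuity of the truncation, the gap and the barycenter *)

Section Convergence.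
Variables (T : Type) (G : set_system T).
Hypothesis FG : Filter G.

Lemma cvg_max0 (f : T -> R) (l : R) : f @ G --> l ->
  Num.max 0 (f z) @[z --> G] --> Num.max 0 l.
Proof.
move=> fl; have c : {for l, continuous (fun x : R => Num.max 0 x)}.
  apply: (@continuous_max R R (fun=> 0) id).
    exact: (@cst_continuous _ _ (0 : R^o) l).
  exact: cvg_id.
exact: (cvg_comp _ _ fl c).
Qed.

Lemma cvg_level A l : lf_cvg G A l -> level (A z) @[z --> G] --> level l.
Proof.
move=> [F [l0 A0] Al]; apply: cvgM; last exact: cvg_cst.
apply: (@cvg_fsbig _ _ _ _ _ R^o F).
- by move=> v /l0 ->; rewrite expr0n.
- by apply: filterS A0 => z A0 v /A0 ->; rewrite expr0n.
- by move=> v; rewrite expr2; apply: cvgM; exact: Al.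
Qed.

Lemma lf_cvg_theta X A l : rips_point X l ->
  lf_cvg G A l -> lf_cvg G (fun z => theta (A z)) (theta l).
Proof.
move=> Xl Al; apply: lf_cvg_normalize.
  have [_ fl _ _ _] := Xl; rewrite gt_eqF// fsbig_gt0//.
  - exact: trunc_ge0.
  - exact: finsupp_trunc.
  - by have [v lt] := level_lt Xl; exists v; rewrite trunc_gt0.
have cl := cvg_level Al; case: Al => F [l0 A0] Al; exists F; first split.
- move=> v /l0 lv; apply: (not_pos0 (trunc_ge0 l)).
  by rewrite trunc_gt0 lv -leNgt level_ge0.
- apply: filterS A0 => z A0 v /A0 lv; apply: (not_pos0 (trunc_ge0 _)).
  by rewrite trunc_gt0 lv -leNgt level_ge0.
- by move=> v; apply: cvg_max0; apply: cvgB => //; exact: Al.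
Qed.

Lemma cvg_gap X A l : rips_point X l ->
  lf_cvg G A l -> gap (A z) @[z --> G] --> gap l.
Proof.
move=> Xl Al; have cl := cvg_level Al; apply: cvgM.
  by rewrite expr2; exact: cvgM.
apply: cvgV; first by rewrite gt_eqF// (gap_denom_gt0 Xl).
apply: cvgD; first exact: cvg_cst.
case: Al => F [l0 A0] Al; apply: (@cvg_fsbig _ _ _ _ _ R^o F).
- by move=> v /l0 lv; rewrite fsbig1// => w _; rewrite lv !mul0r.
- by apply: filterS A0 => z A0 v /A0 lv; rewrite fsbig1// => w _; rewrite lv !mul0r.
- move=> v; apply: (@cvg_fsbig _ _ _ _ _ R^o F).
  + by move=> w /l0 ->; rewrite mulr0 mul0r.
  + by apply: filterS A0 => z A0 w /A0 ->; rewrite mulr0 mul0r.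
  + move=> w; apply: cvgM; last exact: cvg_cst.
    by apply: cvgM; exact: Al.
Qed.

Definition center t : V := \sum_(v \in [set: V]) t v *: v.

Lemma cvg_center A l : lf_cvg G A l -> center (A z) @[z --> G] --> center l.
Proof.
move=> [F [l0 A0] Al]; apply: (@cvg_fsbig _ _ _ _ _ _ F).
- by move=> v /l0 ->; rewrite scale0r.
- by apply: filterS A0 => z A0 v /A0 ->; rewrite scale0r.
- by move=> v; apply: cvgZr_tmp; exact: Al.
Qed.

End Convergence.

Lemma centerE (s : {fset V}) t : (forall v, v \notin s -> t v = 0) ->
  center t = \sum_(v <- s) t v *: v.
Proof. by move=> ts; rewrite /center (fsbigTE s)// => v /ts ->; rewrite scale0r. Qed.

End RipsPoints.

(** * Spreading a point over nearby points of M *)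

Section DenseSequence.
Variables (R : realType) (n : nat) (M : set 'rV[R]_n).
Local Notation V := 'rV[R]_n.

Lemma rat_approx (x : V) (e : R) : 0 < e ->
  exists q : 'rV[rat]_n, `|x - map_mx ratr q| < e.
Proof.
move=> e0; have q_ i : {q : rat | ratr q \in `]x ord0 i - e, x ord0 i + e[}.
  by apply/cid/rat_in_itvoo; lra.
exists (\row_i sval (q_ i)).
rewrite [ltLHS]/Num.norm/= mx_normrE; apply/bigmax_ltP; split=> //= -[i j] _ /=.
rewrite !mxE (ord1 i); have := svalP (q_ j); rewrite in_itv/= => /andP[q1 q2].
by rewrite ltr_norml; apply/andP; split; lra.
Qed.

Definition dense_index (i : nat) : 'rV[rat]_n * nat :=
  odflt (0, 0%N) (choice.unpickle i).

(** One point of [M] for each rational ball meeting [M]; for the other balls the default is some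
    point of [M], so that the sequence stays in a nonempty [M]. *)
Definition dense_seq (i : nat) : V :=
  let: (q, k) := dense_index i in
  xget (xget 0 M) [set y | M y /\ `|y - map_mx ratr q| < k.+1%:R^-1].

Lemma dense_seq_in i : M !=set0 -> M (dense_seq i).
Proof.
move=> [m Mm]; rewrite /dense_seq; case: dense_index => q k.
by case: xgetP => [y _ []//|_]; exact: xgetI Mm.
Qed.

Lemma dense_seq_near x e : M x -> 0 < e -> exists i, eucl_dist x (dense_seq i) < e.
Proof.
move=> Mx e0.
have /nbhs_ballP[r /= r0 rP] : nbhs x [set y | eucl_dist x y < e].
  have /cvgrPdist_lt/(_ e e0) := @eucl_dist_continuous R n x x.
  apply: filterS => y /=.
  by rewrite eucl_distxx sub0r normrN ger0_norm// eucl_dist_ge0.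
have [k kr] : exists k, k.+1%:R^-1 < r / 2.
  have [k kr] := ltr_add_invr (y := 0) (x := r / 2) (divr_gt0 r0 (ltr0Sn _ 1)).
  by exists k; rewrite add0r in kr.
have k0 : 0 < k.+1%:R^-1 :> R by rewrite invr_gt0.
have [q xq] := rat_approx x k0.
exists (choice.pickle (q, k)); rewrite /dense_seq /dense_index choice.pickleK/=.
apply: rP; rewrite -ball_normE /ball_/=.
case: xgetP => [y _ [My yq]|/(_ x)[]//].
rewrite -(subrKA (map_mx ratr q)); apply: le_lt_trans (ler_normD _ _) _.
rewrite (distrC _ y) [ltRHS]splitr.
exact: ltrD (lt_trans xq kr) (lt_trans yq kr).
Qed.

Definition cover (x : V) (eta : R) (i : nat) : R :=
  Num.max 0 (eta - eucl_dist x (dense_seq i)).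

(* Milnor's trick: subtracting the earlier functions of the sequence makes the
   family locally finite without shrinking the union of the supports. *)
Definition cut x eta i : R :=
  Num.max 0 (cover x eta i - i%:R * \sum_(j < i) cover x eta j).

(** The sequence may repeat points, so the functions indexed by positions are collected by
    vertex. *)
Definition bump x eta (v : V) : R :=
  \sum_(i \in [set: nat]) cut x eta i * (dense_seq i == v)%:R.

(** The values at [x] of a partition of unity subordinate to the balls of radius [eta] around the
    points of the sequence, with [eta] allowed to vary. *)
Definition nearby x eta : V -> R := normalize (bump x eta).

Lemma cover_ge0 x eta i : 0 <= cover x eta i.
Proof. by rewrite /cover le_max lexx. Qed.

Lemma cut_ge0 x eta i : 0 <= cut x eta i.
Proof. by rewrite /cut le_max lexx. Qed.

Lemma cut_gt0 x eta i : 0 < cut x eta i -> eucl_dist x (dense_seq i) < eta.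
Proof.
rewrite /cut lt_max ltxx/= => lt.
have : 0 < cover x eta i.
  rewrite subr_gt0 in lt; apply: le_lt_trans lt; rewrite mulr_ge0// sumr_ge0// => j _.
  exact: cover_ge0.
by rewrite /cover lt_max ltxx/= subr_gt0.
Qed.

(** From index [N] on, at least [N%:R * a >= eta] is subtracted from a function bounded by [eta].
    Such an [N] also works for nearby [x] and [eta], whence local finiteness. *)
Lemma cut_eq0 x eta a i0 N : 0 <= a -> a <= cover x eta i0 -> (i0 < N)%N ->
  eta <= N%:R * a -> forall i, (N <= i)%N -> cut x eta i = 0.
Proof.
move=> a0 ac i0N Na i Ni; apply/eqP; rewrite eq_le cut_ge0 andbT /cut ge_max lexx/=.
rewrite subr_le0.
have sa : a <= \sum_(j < i) cover x eta j.
  have i0i : (i0 < i)%N by exact: leq_trans Ni.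
  rewrite (bigD1 (Ordinal i0i))//=; apply: le_trans ac _; rewrite lerDl sumr_ge0// => j _.
  exact: cover_ge0.
have Nai : N%:R * a <= i%:R * \sum_(j < i) cover x eta j.
  by apply: ler_pM => //; rewrite ler_nat.
rewrite ge_max; apply/andP; split; first by apply: le_trans Nai; rewrite mulr_ge0.
by have := eucl_dist_ge0 x (dense_seq i); lra.
Qed.

Lemma bump_ge0 x eta v : 0 <= bump x eta v.
Proof. by apply: fsumr_ge0 => i _; rewrite mulr_ge0 ?cut_ge0. Qed.

Lemma bump_gt0 x eta v :
  0 < bump x eta v -> exists2 i, dense_seq i = v & 0 < cut x eta i.
Proof.
move=> /(fsumr_gt0 [::])[i _]; have [<-|_] := eqVneq; last by rewrite mulr0 ltxx.
by rewrite mulr1; exists i.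
Qed.

Lemma bump_support x eta N : (forall i, (N <= i)%N -> cut x eta i = 0) ->
  forall v, v \notin [fset dense_seq i | i in iota 0 N]%fset -> bump x eta v = 0.
Proof.
move=> cN v vF; apply: (not_pos0 (bump_ge0 x eta)).
apply: contraNN vF => /bump_gt0[i <- ci].
apply/imfsetP; exists i => //=; rewrite mem_iota/= add0n ltnNge.
by apply: contraTN ci => /cN ->; rewrite ltxx.
Qed.

Section Point.
Variables (x : V) (eta : R).
Hypotheses (Mx : M x) (eta0 : 0 < eta).

Lemma cut_finite : exists2 N, (0 < N)%N & forall i, (N <= i)%N -> cut x eta i = 0.
Proof.
have e2 : 0 < eta / 2 by rewrite divr_gt0.
have [i0 xi0] := dense_seq_near Mx e2.
exists (maxn i0.+1 2); first by rewrite leq_max.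
apply: (@cut_eq0 _ _ (eta / 2) i0); first exact: ltW.
- by rewrite /cover le_max; apply/orP; right; lra.
- by rewrite leq_max ltnSn.
- have : 2 <= (maxn i0.+1 2)%:R :> R by rewrite ler_nat leq_maxr.
  by move=> N2; apply: le_trans (ler_wpM2r (ltW e2) N2); lra.
Qed.

Lemma finsupp_bump : finsupp (bump x eta).
Proof. by have [N _ /bump_support Nv] := cut_finite; exact: ex_intro Nv. Qed.

(** At the first index with a positive cover function, the subtracted sum is 0. *)
Lemma bump_pos : exists v, 0 < bump x eta v.
Proof.
have [i0 xi0] := dense_seq_near Mx eta0.
have ex : exists i, 0 < cover x eta i.
  by exists i0; rewrite /cover lt_max subr_gt0 xi0 orbT.
case: (ex_minnP ex) => i ci imin; exists (dense_seq i).
have cuti : 0 < cut x eta i.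
  rewrite /cut big1 => [|j _].
    by rewrite mulr0 subr0; apply: lt_le_trans ci _; rewrite le_max lexx orbT.
  apply: (not_pos0 (cover_ge0 x eta)); apply/negP => /imin.
  by rewrite leqNgt ltn_ord.
have [N _ cN] := cut_finite.
have iN : (i < N)%N by rewrite ltnNge; apply: contraTN cuti => /cN ->; rewrite ltxx.
rewrite /bump (fsbigTE [fset j | j in iota 0 N]%fset); last first.
  move=> j jN; rewrite cN ?mul0r// leqNgt; apply: contraNN jN => jN.
  by apply/imfsetP; exists j; rewrite //= mem_iota.
rewrite (big_fsetD1 i)/=; last by apply/imfsetP; exists i; rewrite //= mem_iota.
rewrite eqxx mulr1 ltr_pwDl// sumr_ge0// => j _.
by rewrite mulr_ge0 ?cut_ge0.
Qed.

Lemma nearby_gt0 v : 0 < nearby x eta v -> M v /\ eucl_dist x v < eta.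
Proof.
move=> /(normalize_gt0 (bump_ge0 x eta))/bump_gt0[i <- /cut_gt0]; split=> //.
by apply: dense_seq_in; exists x.
Qed.

Lemma rips_point_nearby delta (X : set V) : eta <= delta / 2 ->
  (forall v, M v -> eucl_dist x v < eta -> X v) ->
  rips_point delta X (nearby x eta).
Proof.
move=> etad MX.
have near v : 0 < bump x eta v -> M v /\ eucl_dist x v < eta.
  move=> /bump_gt0[i <- /cut_gt0]; split=> //.
  by apply: dense_seq_in; exists x.
apply: rips_point_normalize.
- exact: bump_ge0.
- exact: finsupp_bump.
- exact: bump_pos.
- by move=> v /near[]; exact: MX.
- move=> v w /near[_ xv] /near[_ xw].
  by apply: le_lt_trans (eucl_dist_triangle x _ _) _; rewrite (eucl_distC v); lra.
Qed.

Lemma lf_cvg_nearby (T : Type) (G : set_system T) (f : T -> V) (g : T -> R) :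
  Filter G -> f @ G --> x -> g @ G --> eta ->
  lf_cvg G (fun z => nearby (f z) (g z)) (nearby x eta).
Proof.
move=> FG fx geta; apply: lf_cvg_normalize.
  by rewrite gt_eqF// fsbig_gt0//; [exact: bump_ge0|exact: finsupp_bump|exact: bump_pos].
have cvg_cover i : cover (f z) (g z) i @[z --> G] --> cover x eta i.
  apply: cvg_max0; apply: cvgB => //; apply: cvg_eucl_dist => //; exact: cvg_cst.
have cvg_cut i : cut (f z) (g z) i @[z --> G] --> cut x eta i.
  apply: cvg_max0; apply: cvgB => //; apply: cvgM; first exact: cvg_cst.
  by apply: cvg_big => [|j _]; [exact: add_continuous|exact: cvg_cover].
have e2 : 0 < eta / 2 by rewrite divr_gt0.
have [i0 xi0] := dense_seq_near Mx e2.
(* The factor 4, instead of the 2 used at a fixed point: near the limit [g z] may approach [2 * eta]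
   while the cover function at [i0] is only known to exceed [eta / 2]. *)
pose N := maxn i0.+1 4.
have N4 : 4 <= N%:R :> R by rewrite ler_nat leq_maxr.
have i0N : (i0 < N)%N by rewrite leq_max ltnSn.
have c0 : eta / 2 < cover x eta i0.
  by rewrite /cover lt_max; apply/orP; right; lra.
have cN : \forall z \near G, forall i, (N <= i)%N -> cut (f z) (g z) i = 0.
  have n1 : \forall z \near G, eta / 2 < cover (f z) (g z) i0.
    exact: (cvgr_gt _ (cvg_cover i0)).
  have n2 : \forall z \near G, g z < 2 * eta.
    by apply: (cvgr_lt _ geta); lra.
  apply: filterS2 n1 n2 => z n1 n2.
  apply: (@cut_eq0 _ _ (eta / 2) i0) => //; try exact: ltW.
  by apply: le_trans (ler_wpM2r (ltW e2) N4); lra.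
have cN0 i : (N <= i)%N -> cut x eta i = 0.
  apply: (@cut_eq0 _ _ (eta / 2) i0) => //; try exact: ltW.
  by apply: le_trans (ler_wpM2r (ltW e2) N4); lra.
exists [fset dense_seq i | i in iota 0 N]%fset; first split.
- exact: bump_support.
- by apply: filterS cN => z; exact: bump_support.
- have notN i : i \notin [fset j | j in iota 0 N]%fset -> (N <= i)%N.
    move=> iN; rewrite leqNgt; apply: contraNN iN => iN.
    by apply/imfsetP; exists i; rewrite //= mem_iota.
  move=> v; apply: (@cvg_fsbig _ _ _ _ _ R^o [fset j | j in iota 0 N]%fset).
  + by move=> i /notN /cN0 ->; rewrite mul0r.
  + by apply: filterS cN => z cN i /notN /cN ->; rewrite mul0r.
  + by move=> i; apply: cvgM; [exact: cvg_cut|exact: cvg_cst].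
Qed.

End Point.
End DenseSequence.

(** * The projection on a tube *)

Section Tube.
Variables (R : realType) (n : nat) (M : set 'rV[R]_n) (kappa rho : R).
Local Notation V := 'rV[R]_n.
Local Notation proj := (proj M).
Local Notation distM := (distM M).
Hypotheses (cM : closed M) (M0 : M !=set0).
Hypotheses (kappa0 : 0 <= kappa) (rho0 : 0 <= rho) (kr1 : kappa * rho < 1).
(* Federer's inequality; [kappa] is the inverse of the reach, 0 if the latter is
   infinite. *)
Hypothesis federer : forall x y, distM x <= rho -> M y ->
  2 * dot (x - proj x) (y - proj x) <= kappa * distM x * eucl_dist y (proj x) ^+ 2.

Lemma distM_in x : M x -> distM x = 0.
Proof.
move=> Mx; apply/eqP; rewrite eq_le distM_ge0 andbT -(eucl_distxx x).
exact: distM_le.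
Qed.

Lemma proj_id x : M x -> proj x = x.
Proof. by move=> /distM_in /eucl_dist_eq0. Qed.

(** Federer's inequality at [x] against [proj y] and at [y] against [proj x] bounds
    [dot (x - y) (p - q)] below by [1 - kappa * rho] times the squared distance of the projections;
    Cauchy-Schwarz bounds it above. *)
Lemma proj_lip x y : distM x <= rho -> distM y <= rho ->
  eucl_dist (proj x) (proj y) <= (1 - kappa * rho)^-1 * eucl_dist x y.
Proof.
move=> xr yr; have a0 : 0 < 1 - kappa * rho by rewrite subr_gt0.
set p := proj x; set q := proj y.
have fx := federer xr (proj_in cM M0 y); have fy := federer yr (proj_in cM M0 x).
rewrite -/p -/q in fx fy.
have [D0|D0] := eqVneq (eucl_dist p q) 0.
  by rewrite D0 mulr_ge0 ?eucl_dist_ge0// invr_ge0 ltW.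
have {}D0 : 0 < eucl_dist p q by rewrite lt_def D0 eucl_dist_ge0.
rewrite ler_pdivlMl// -(ler_pM2r D0); apply: le_trans (dot_le_dist x y p q).
have {}fx : 2 * dot (x - p) (q - p) <= kappa * rho * eucl_dist p q ^+ 2.
  apply: le_trans fx _; rewrite (eucl_distC q p) ler_wpM2r ?sqr_ge0//.
  by rewrite ler_wpM2l.
have {}fy : 2 * dot (y - q) (p - q) <= kappa * rho * eucl_dist p q ^+ 2.
  by apply: le_trans fy _; rewrite ler_wpM2r ?sqr_ge0// ler_wpM2l.
have E : dot (x - y) (p - q) =
    eucl_dist p q ^+ 2 - dot (x - p) (q - p) - dot (y - q) (p - q).
  rewrite eucl_dist_sqr; have -> : x - y = (x - p) + (p - q) - (y - q).
    by rewrite addrA subrK opprB addrA subrK.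
  have -> : q - p = - (p - q) by rewrite opprB.
  move: (x - p) (y - q) (p - q) => a b c.
  rewrite !dotE; ring.
by rewrite E; move: fx fy; rewrite !expr2; lra.
Qed.

Lemma cvg_proj (T : Type) (G : set_system T) (f : T -> V) x : Filter G ->
  distM x <= rho -> (\forall z \near G, distM (f z) <= rho) ->
  f @ G --> x -> proj (f z) @[z --> G] --> proj x.
Proof.
move=> FG xr fr fx; apply: cvg_eucl.
have d0 : (1 - kappa * rho)^-1 * eucl_dist (f z) x @[z --> G] --> (0 : R).
  rewrite -(mulr0 (1 - kappa * rho)^-1) -(eucl_distxx x).
  apply: cvgM; first exact: cvg_cst.
  by apply: cvg_eucl_dist => //; exact: cvg_cst.
apply: squeeze_cvgr (cvg_cst (0 : R)) d0.
by apply: filterS fr => z zr; rewrite eucl_dist_ge0/=; exact: proj_lip.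
Qed.

(** The weighted mean of Federer's inequality at [x] over the vertices: on the left the mean of
    [v - p] is [x - p], on the right the parallel axis identity applies. *)
Lemma distM_center_sqr (s : seq V) (t : V -> R) : weights s t ->
  (forall v, v \in s -> M v) ->
  let x := \sum_(v <- s) t v *: v in distM x <= rho ->
  2 * distM x ^+ 2 <=
    kappa * distM x * (distM x ^+ 2 + \sum_(v <- s) t v * eucl_dist x v ^+ 2).
Proof.
move=> wst sM x xr; have [us t0 t1] := wst; set p := proj x.
have -> : distM x ^+ 2 = eucl_dist p x ^+ 2 by rewrite eucl_distC.
rewrite -(barycenter_sqdist _ wst) mulr_sumr.
have -> : 2 * eucl_dist p x ^+ 2 = \sum_(v <- s) t v * (2 * dot (x - p) (v - p)).
  rewrite eucl_distC eucl_dist_sqr.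
  under eq_bigr do rewrite mulrCA -dotZr.
  rewrite -mulr_sumr -dot_sumr; congr (_ * dot _ _).
  under eq_bigr do rewrite scalerBr.
  by rewrite sumrB -scaler_suml t1 scale1r.
rewrite big_seq [leRHS]big_seq; apply: ler_sum => v vs; rewrite [leRHS]mulrCA.
apply: ler_wpM2l; first exact: t0.
by rewrite (eucl_distC p v); apply: federer => //; exact: sM.
Qed.

(* Hence the projection can be added to the simplex as a new vertex. *)
Lemma proj_center_vertex (s : seq V) (t : V -> R) (d : R) v :
  weights s t -> (forall v, v \in s -> M v) ->
  {in s &, forall v w, eucl_dist v w <= d} -> kappa * d < 1 -> 0 <= d ->
  distM (\sum_(v <- s) t v *: v) <= rho -> v \in s ->
  eucl_dist (proj (\sum_(v <- s) t v *: v)) v <= d.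
Proof.
move=> wst sM sd kd1 d0; set x := \sum_(v <- s) _ => xr vs.
have [us t0 t1] := wst.
set p := proj x; set D := eucl_dist p v.
have D0 : 0 <= D by exact: eucl_dist_ge0.
pose r := distM x; have r0 : 0 <= r by exact: distM_ge0.
pose q := \sum_(v <- s) t v * eucl_dist x v ^+ 2.
have q0 : 0 <= q.
  by rewrite /q big_seq sumr_ge0// => w ws; rewrite mulr_ge0 ?t0 ?sqr_ge0.
have H3 : 2 * r ^+ 2 <= kappa * r * (r ^+ 2 + q) by exact: distM_center_sqr.
have H2 : eucl_dist v x ^+ 2 + q <= d ^+ 2.
  rewrite -(barycenter_sqdist _ wst) -[leRHS]mul1r -t1 mulr_suml.
  rewrite big_seq [leRHS]big_seq; apply: ler_sum => w ws.
  apply: ler_wpM2l; first exact: t0.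
  by rewrite ler_sqr ?nnegrE ?eucl_dist_ge0// sd.
(* The law of cosines in the triangle [x], [p], [v], with Federer's inequality for the product. *)
have H1 : r ^+ 2 + D ^+ 2 - kappa * r * D ^+ 2 <= eucl_dist v x ^+ 2.
  have := federer xr (sM _ vs); rewrite -/p -/r -/D (eucl_distC v p).
  rewrite (eucl_distC v x) -[r ^+ 2]/(eucl_dist x p ^+ 2) /D !eucl_dist_sqr.
  have -> : x - v = (x - p) - (v - p) by rewrite opprB addrA subrK.
  have -> : p - v = - (v - p) by rewrite opprB.
  move: (x - p) (v - p) => a b; rewrite !dotE (dotC b a) opprK; lra.

rewrite leNgt; apply/negP => ltD.
have ltD2 : d ^+ 2 < D ^+ 2 by rewrite ltr_sqr.
have [re|rn] := eqVneq r 0.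
  move: H1; rewrite re; have := sqr_ge0 r; rewrite mulr0 mul0r; rewrite expr0n/=; lra.
have {rn}rp : 0 < r by rewrite lt_def rn.
have kr : kappa * r < 1 by apply: le_lt_trans kr1; rewrite ler_wpM2l.
have {}H3 : 2 * r <= kappa * (r ^+ 2 + q).
  by rewrite -(ler_pM2r rp); move: H3; rewrite !expr2; lra.
have k2d2 : kappa ^+ 2 * d ^+ 2 < 1.
  by rewrite -exprMn expr_lt1// mulr_ge0.
(* The sum of [A] and [B] gives [kappa * (r ^+ 2 + q) <= kappa ^+ 2 * d ^+ 2 * r], which is less
   than [r] by [C], whereas [H3] makes the left side at least [2 * r]. *)
have A : 0 <= kappa * (1 - kappa * r) * (D ^+ 2 - d ^+ 2).
  by rewrite mulr_ge0 ?mulr_ge0// subr_ge0 ltW.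
have B : 0 <= kappa * (d ^+ 2 - q - r ^+ 2 - D ^+ 2 + kappa * r * D ^+ 2).
  by rewrite mulr_ge0//; lra.
have C : 0 < r * (1 - kappa ^+ 2 * d ^+ 2) by rewrite mulr_gt0// subr_gt0.
by move: A B C H3; rewrite !expr2; lra.
Qed.

(** Vertices are fixed by the projection, so its Lipschitz bound carries Jung's estimate over to the
    projected barycenter. *)
Lemma center_near_vertex (s : seq V) (t : V -> R) (d : R) :
  weights s t -> (forall v, v \in s -> M v) ->
  {in s &, forall v w, eucl_dist v w <= d} -> 0 <= d -> jung R n * d <= rho ->
  let x := \sum_(v <- s) t v *: v in
  distM x <= rho /\ exists2 v, v \in s &
    eucl_dist (proj x) v <= (1 - kappa * rho)^-1 * (jung R n * d).
Proof.
move=> wst sM sd d0 Jd x; have [v vs xv] := jung_vertex wst d0 sd.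
have xr : distM x <= rho.
  by apply: le_trans Jd; apply: le_trans xv; apply: distM_le => //; exact: sM.
split=> //; exists v => //; rewrite -{1}(proj_id (sM _ vs)).
apply: (le_trans (proj_lip xr _)); first by rewrite distM_in ?rho0//; exact: sM.
by rewrite ler_wpM2l// invr_ge0 subr_ge0 ltW.
Qed.

End Tube.

(** * The interleaving *)

Section Interleaving.
Variables (R : realType) (n N : nat) (M : set 'rV[R]_n).
Variables (f : 'rV[R]_n -> 'rV[R]_N) (L delta kappa eps : R).
Local Notation V := 'rV[R]_n.
Local Notation J := (jung R n).
Local Notation rho := (J * delta).
Local Notation E := (1 - kappa * rho)^-1.
Local Notation sub := (sublevel M f).
Local Notation MF := (sublevel_pspace M f).
Local Notation RF := (rips_pspace M f delta).
Hypotheses (n0 : (0 < n)%N) (cM : closed M) (M0 : M !=set0).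
Hypotheses (fL : lipschitz_inf M f L) (delta0 : 0 < delta).
Hypotheses (kappa0 : 0 <= kappa) (kappa_rho : kappa * rho <= (1 - J) / (1 + J)).
Hypothesis federer : forall x y, distM M x <= rho -> M y ->
  2 * dot (x - proj M x) (y - proj M x)
    <= kappa * distM M x * eucl_dist y (proj M x) ^+ 2.
Hypothesis epsE : eps = E * L * J * delta.

Lemma jung_ge_half : 1 / 2 <= J.
Proof.
rewrite -ler_sqr ?nnegrE ?jung_ge0 ?divr_ge0//.
rewrite jung_sqr ler_pdivlMr; last by rewrite mulr_gt0.
have : 1 <= n%:R :> R by rewrite ler1n.
by rewrite -[n.+1%:R]natr1 expr2; lra.
Qed.

Lemma rho_ge0 : 0 <= rho.
Proof. by rewrite mulr_ge0 ?jung_ge0 ?ltW. Qed.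

Lemma half_le_rho : delta / 2 <= rho.
Proof. by have := ler_wpM2r (ltW delta0) jung_ge_half; lra. Qed.

(** [(1 - J) / (1 + J)] decreases in [J] and equals [1 / 3] at [J = 1 / 2]. *)
Lemma kappa_rho_le : kappa * rho <= 1 / 3.
Proof.
have J2 := jung_ge_half; apply: le_trans kappa_rho _.
by rewrite ler_pdivrMr; lra.
Qed.

Lemma kappa_rho_lt1 : kappa * rho < 1.
Proof. by have := kappa_rho_le; lra. Qed.

(** Since [delta <= 2 * rho]. This is the condition of [proj_center_vertex] for diameters up to
    [delta]. *)
Lemma kappa_delta_lt1 : kappa * delta < 1.
Proof.
have := ler_wpM2l kappa0 half_le_rho; have := kappa_rho_le; lra.
Qed.

Lemma E_ge1 : 1 <= E.
Proof.
rewrite invf_ge1 ?subr_gt0 ?kappa_rho_lt1//.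
by rewrite gerBl mulr_ge0 ?rho_ge0.
Qed.

Lemma eps_ge0 : 0 <= eps.
Proof.
have [L0 _] := fL; have := E_ge1.
rewrite epsE => E1; rewrite !mulr_ge0 ?jung_ge0 ?(ltW delta0)//.
exact: le_trans E1.
Qed.

Lemma half_le_Erho : delta / 2 <= E * rho.
Proof.
apply: le_trans half_le_rho _; rewrite -[leLHS]mul1r.
by apply: ler_wpM2r; [exact: rho_ge0|exact: E_ge1].
Qed.

Lemma sublevel_in u x : sub u x -> M x.
Proof. by case. Qed.

Lemma sublevel_shift (u : 'rV[R]_N) : sub u `<=` sub (u + const_mx eps).
Proof. by apply: sublevel_mono; exact: lev_add eps_ge0. Qed.

(** This fixes the size of the shift: a displacement of [E * rho] in [M] changes each coordinate of
    [f] by at most [L * (E * rho)], that is [eps]. *)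
Lemma sublevel_near u x y : sub u x -> M y -> eucl_dist x y <= E * rho ->
  sub (u + const_mx eps) y.
Proof.
move=> [Mx /forallP xu] My xy; split=> //; apply/forallP => i; rewrite !mxE.
have [L0 /(_ _ _ My Mx) fxy] := fL.
have : `|f y ord0 i - f x ord0 i| <= `|f y - f x|.
  rewrite [leRHS]/Num.norm/= mx_normrE.
  have -> : f y ord0 i - f x ord0 i = (f y - f x) ord0 i by rewrite !mxE.
  exact: (@le_bigmax _ _ _ 0
    (fun p : 'I_1 * 'I_N => `|(f y - f x) p.1 p.2|) (ord0, i)).
have : L * eucl_dist y x <= eps.
  rewrite eucl_distC epsE; apply: le_trans (ler_wpM2l L0 xy) _.
  by rewrite le_eqVlt; apply/orP; left; apply/eqP; ring.
have := xu i; have := ler_norm (f y ord0 i - f x ord0 i); lra.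
Qed.

(** * The two maps of the interleaving *)

Definition psi (t : V -> R) : V := proj M (center t).

Lemma rips_point_in u t : rips_point delta (sub u) t -> rips_point delta M t.
Proof. by apply: rips_pointS => x; exact: sublevel_in. Qed.

Lemma psi_near X t : X `<=` M -> rips_point delta X t ->
  distM M (center t) <= rho /\
  exists2 v, X v & eucl_dist (psi t) v <= E * rho.
Proof.
move=> XM Xt; have [s [sE wst ts]] := rips_point_weights Xt.
have [_ _ _ tX td] := Xt.
rewrite /psi (centerE ts).
have sX v : v \in s -> X v by rewrite sE; exact: tX.
have sd : {in s &, forall v w, eucl_dist v w <= delta}.
  by move=> v w; rewrite !sE => tv tw; exact/ltW/td.
have sM v : v \in s -> M v by move=> /sX /XM.
have [xr [v vs xv]] := center_near_vertex cM M0 kappa0 rho_ge0 kappa_rho_lt1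
  federer wst sM sd (ltW delta0) (lexx _).
by split=> //; exists v => //; exact: sX.
Qed.

Lemma psi_sublevel u t : rips_point delta (sub u) t ->
  sub (u + const_mx eps) (psi t).
Proof.
move=> /psi_near[|_ [v uv tv]]; first by move=> x; exact: sublevel_in.
by apply: (sublevel_near uv); [exact: proj_in|rewrite eucl_distC].
Qed.

Lemma cvg_psi (T : Type) (G : set_system T) (A : T -> V -> R) l : Filter G ->
  (forall z, rips_point delta M (A z)) -> rips_point delta M l ->
  lf_cvg G A l -> psi (A z) @[z --> G] --> psi l.
Proof.
move=> FG MA Ml Al.
apply: (cvg_proj cM M0 kappa0 kappa_rho_lt1 federer).
- by have [] := psi_near (@subset_refl _ M) Ml.
- by apply: nearW => z; have [] := psi_near (@subset_refl _ M) (MA z).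
- exact: cvg_center.
Qed.

Lemma rips_point_nearby_sub u x eta : sub u x -> 0 < eta <= delta / 2 ->
  rips_point delta (sub (u + const_mx eps)) (nearby M x eta).
Proof.
move=> ux /andP[eta0 eta2]; apply: rips_point_nearby => //.
  exact: sublevel_in ux.
move=> v Mv xv; apply: (sublevel_near ux) => //.
by apply: le_trans half_le_Erho; apply: le_trans eta2; exact: ltW.
Qed.

Lemma half_delta : 0 < delta / 2 <= delta / 2.
Proof. by rewrite divr_gt0 ?lexx. Qed.

Definition phi_phom : phom MF (pshift eps RF).
Proof.
exists (fun u (x : MF u) =>
  georeal_of (rips_point_nearby_sub (set_valP x) half_delta) : pshift eps RF u).
- move=> u x; have [eta0 _] := andP half_delta.
  apply: (@georeal_cvg _ _ _ _ (nbhs x) _ _ (nbhs_filter x)).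
  have c1 : set_val z @[z --> x] --> (set_val x : V) by exact: initial_continuous.
  by apply: (lf_cvg_nearby (sublevel_in (set_valP x)) eta0 _ c1); exact: cvg_cst.
- by move=> u v uv x; exact: georeal_ext.
Defined.

Definition psi_phom : phom RF (pshift eps MF).
Proof.
exists (fun u (t : RF u) =>
  SigSub (mem_set (psi_sublevel (rips_point_georeal t))) : pshift eps MF u).
- move=> u; apply: continuous_comp_initial; apply: georeal_continuous => s t Ks st.
  apply: cvg_psi.
  + by move=> z; exact: rips_point_in (rips_point_georeal z).
  + exact: rips_point_in (rips_point_georeal t).
  + exact: lf_cvg_bary.
- by move=> u v uv x; exact: val_inj.
Defined.

Definition clamp (r : R) : R := Num.max 0 (Num.min 1 r).

Lemma clamp01 r : 0 <= clamp r <= 1.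
Proof. by rewrite /clamp le_max lexx ge_max ler01/= ge_min lexx. Qed.

Lemma clamp0 : clamp 0 = 0. Proof. by rewrite /clamp minElt ltr10 maxxx. Qed.

Lemma clamp1 : clamp 1 = 1.
Proof. by rewrite /clamp minxx maxElt ltr01. Qed.

Lemma clamp_continuous : continuous clamp.
Proof.
move=> r; apply: cvg_max0.
have := @continuous_min R R (fun=> 1) id r; apply; last exact: cvg_id.
exact: (@cst_continuous _ _ (1 : R^o) r).
Qed.

Lemma psi_phi_homotopic : ho_eq
  (ho_hom (phom_comp (phom_shift eps psi_phom) phi_phom))
  (ho_hom (structure_map2 eps_ge0 MF)).
Proof.
pose h (x : V) (r : R) := (1 - r) *: center (nearby M x (delta / 2)) + r *: x.
have hx x r : M x -> 0 <= r <= 1 -> eucl_dist x (h x r) <= delta / 2.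
  move=> Mx /andP[r0 r1].
  have Mt : rips_point delta M (nearby M x (delta / 2)).
    by apply: rips_point_nearby => //; have /andP[] := half_delta.
  have [s [sE wst ts]] := rips_point_weights Mt; have [us t0 t1] := wst.
  (* A barycenter of points within [delta / 2] of [x] is within [delta / 2] of [x], by the parallel
     axis identity. *)
  have xc : eucl_dist x (center (nearby M x (delta / 2))) <= delta / 2.
    rewrite -ler_sqr ?nnegrE ?eucl_dist_ge0 ?divr_ge0 ?(ltW delta0)//.
    rewrite (centerE ts).
    have := barycenter_sqdist x wst; set c := \sum_(v <- s) _ *: _ => bc.
    apply: (@le_trans _ _
      (\sum_(v <- s) nearby M x (delta / 2) v * eucl_dist x v ^+ 2)).
      rewrite bc lerDl big_seq sumr_ge0// => v vs.
      by rewrite mulr_ge0 ?sqr_ge0 ?t0.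
    have -> : (delta / 2) ^+ 2 =
        \sum_(v <- s) nearby M x (delta / 2) v * (delta / 2) ^+ 2.
      by rewrite -mulr_suml t1 mul1r.
    rewrite big_seq [leRHS]big_seq; apply: ler_sum => v vs.
    apply: ler_wpM2l; first exact: t0.
    rewrite ler_sqr ?nnegrE ?eucl_dist_ge0 ?divr_ge0 ?(ltW delta0)//.
    by move: vs; rewrite sE => /(nearby_gt0 Mx)[_ /ltW].
  apply: le_trans xc; rewrite /h; move: (center _) => c.
  rewrite !eucl_distE; have -> : x - ((1 - r) *: c + r *: x) = (1 - r) *: (x - c).
    by rewrite scalerBr [in RHS]scalerBl scale1r opprD addrCA addrC.
  rewrite dotZl dotZr mulrA -expr2 sqrtrM ?sqr_ge0// sqrtr_sqr ger0_norm ?subr_ge0//.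
  by rewrite ler_piMl ?sqrtr_ge0// gerBl.
have hr x r : M x -> 0 <= r <= 1 -> distM M (h x r) <= rho.
  move=> Mx r01; apply: le_trans half_le_rho; apply: le_trans (hx x r Mx r01).
  by rewrite eucl_distC; exact: distM_le.
have hu u x r : sub u x -> 0 <= r <= 1 ->
    sub (u + const_mx eps + const_mx eps) (proj M (h x r)).
  (* The homotopy already stays within one shift by [eps]; the second shift is mere inclusion. *)
  move=> ux r01; have Mx := sublevel_in ux; apply: sublevel_shift.
  apply: (sublevel_near ux); first exact: proj_in.
  rewrite -{1}(proj_id cM M0 Mx).
  apply: le_trans (proj_lip cM M0 kappa0 kappa_rho_lt1 federer _ (hr x r Mx r01)) _.
    by rewrite (distM_in cM M0 Mx) rho_ge0.
  apply: ler_wpM2l; first exact: le_trans E_ge1.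
  exact: le_trans (hx x r Mx r01) half_le_rho.
apply: (@homotopic_ho_eq _ _ _ _ _ _ (fun u (p : MF u * R) =>
  SigSub (mem_set (hu u _ _ (set_valP p.1) (clamp01 p.2)))
    : pshift eps (pshift eps MF) u)).
- move=> u; apply: continuous_comp_initial => -[x r].
  have Mx := sublevel_in (set_valP x).
  have c1 : set_val p.1 @[p --> (x, r)] --> (set_val x : V).
    have cx : set_val y @[y --> x] --> (set_val x : V) by exact: initial_continuous.
    exact: (cvg_comp _ _ (@continuous_fst (MF u) R (x, r)) cx).
  have c2 : clamp p.2 @[p --> (x, r)] --> clamp r.
    exact: (cvg_comp _ _ (@continuous_snd (MF u) R (x, r)) (@clamp_continuous r)).
  apply: (cvg_proj cM M0 kappa0 kappa_rho_lt1 federer).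
  + by apply: hr => //; exact: clamp01.
  + by apply: nearW => p; apply: hr; [exact: sublevel_in (set_valP p.1)|exact: clamp01].
  + apply: cvgD; apply: cvgZ => //.
      by apply: cvgB => //; exact: cvg_cst.
    apply: cvg_center; apply: lf_cvg_nearby => //; last exact: cvg_cst.
    by have /andP[] := half_delta.
- by move=> u v uv x r; exact: val_inj.
- move=> u x; apply: val_inj => /=.
  by rewrite clamp0 /h subr0 scale1r scale0r addr0.
- move=> u x; apply: val_inj => /=.
  rewrite clamp1 /h subrr scale0r scale1r add0r proj_id//.
  exact: sublevel_in (set_valP x).
Qed.

(* A homotopy of the Rips filtration towards its shift by [2 eps] given by one
   formula [A] for the barycentric coordinates at all levels. *)
Record coord_homotopy (A : (V -> R) -> R -> V -> R) : Prop := CoordHomotopy {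
  coord_point : forall u t (r : R), 0 <= r <= 1 -> rips_point delta (sub u) t ->
    rips_point delta (sub (u + const_mx eps + const_mx eps)) (A t r);
  coord_cvg : forall (T : Type) (G : set_system T) (B : T -> V -> R) (g : T -> R)
      l (r : R),
    Filter G -> (forall z, rips_point delta M (B z)) -> rips_point delta M l ->
    (forall z, 0 <= g z <= 1) -> 0 <= r <= 1 -> lf_cvg G B l -> g @ G --> r ->
    lf_cvg G (fun z => A (B z) (g z)) (A l r) }.

Definition coord_map A (hA : coord_homotopy A) (r : R) (r01 : 0 <= r <= 1) u
    (t : RF u) : pshift eps (pshift eps RF) u :=
  georeal_of (coord_point hA r01 (rips_point_georeal t)).

Lemma coord_map_continuous A (hA : coord_homotopy A) (r : R) (r01 : 0 <= r <= 1) u :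
  continuous (@coord_map A hA r r01 u).
Proof.
apply: georeal_continuous => s t Ks st; apply: georeal_cvg.
apply: (coord_cvg hA) => //; last exact: cvg_cst.
- by move=> z; exact: rips_point_in (rips_point_georeal z).
- exact: rips_point_in (rips_point_georeal t).
- exact: lf_cvg_bary.
Qed.

Definition coord_phom A (hA : coord_homotopy A) (r : R) (r01 : 0 <= r <= 1) :
  phom RF (pshift eps (pshift eps RF)).
Proof.
exists (coord_map hA r01); first exact: coord_map_continuous.
by move=> u v uv x; exact: georeal_ext.
Defined.

Lemma coord_phom_ho_eq A (hA : coord_homotopy A)
    (r01 : 0 <= (0 : R) <= 1) (r11 : 0 <= (1 : R) <= 1) :
  ho_eq (ho_hom (coord_phom hA r01)) (ho_hom (coord_phom hA r11)).
Proof.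
apply: (@homotopic_ho_eq _ _ _ _ _ _ (fun u (p : RF u * R) =>
  coord_map hA (clamp01 p.2) p.1)).
- move=> u; apply: georeal_prod_continuous => s t r Ks st.
  apply: georeal_cvg.
  apply: (coord_cvg hA (B := fun p => bary p.1) (g := fun p => clamp p.2)).
  + by move=> z; exact: rips_point_in (rips_point_georeal _).
  + exact: rips_point_in (rips_point_georeal t).
  + by move=> z; exact: clamp01.
  + exact: clamp01.
  + have [F [l0 A0] Al] := lf_cvg_bary st; exists F; first split=> //.
      exact: (cvg_fst A0).
    by move=> v; exact: (cvg_comp _ _ cvg_fst (Al v)).
  + have s2 :
        (fun p : RF u * R => p.2) @ filter_prod (simplex_nbhs s t) (nbhs r) --> r.
      exact: cvg_snd.
    exact: (cvg_comp _ clamp s2 (@clamp_continuous r)).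
- by move=> u v uv x r; exact: georeal_ext.
- by move=> u x; apply: georeal_ext => v /=; rewrite clamp0.
- by move=> u x; apply: georeal_ext => v /=; rewrite clamp1.
Qed.

(** * Three homotopies linking the structure map of the Rips filtration to the composite *)

Definition shrink (t : V -> R) (r : R) : V -> R :=
  fun v => (1 - r) * t v + r * theta t v.

Definition join (t : V -> R) (r : R) : V -> R :=
  fun v => (1 - r) * theta t v + r * nearby M (psi (theta t)) (gap delta t) v.

(** The truncation inside [psi] is undone, hence [1 - r], while the scale grows from the gap to
    [delta / 2]: the homotopy leads from the end of [join] to the composite of the two maps. *)
Definition coarsen (t : V -> R) (r : R) : V -> R :=
  nearby M (psi (shrink t (1 - r))) ((1 - r) * gap delta t + r * (delta / 2)).

Lemma shrink0 t : shrink t 0 = t.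
Proof. by apply/funext => v; rewrite /shrink subr0 mul1r mul0r addr0. Qed.

Lemma shrink1 t : shrink t 1 = theta t.
Proof. by apply/funext => v; rewrite /shrink subrr mul1r mul0r add0r. Qed.

Lemma shrink_homotopy : coord_homotopy shrink.
Proof.
split=> [u t r r01 ut|T G B g l r FG MB Ml g01 r01 Bl gr].
  do 2 apply: rips_pointS (@sublevel_shift _) _.
  exact: rips_point_theta_segment.
by apply: lf_cvg_segment => //; exact: lf_cvg_theta Ml Bl.
Qed.

(** A vertex of [theta t] is within [delta - gap delta t] of the projected barycenter, by [gap_le]
    and [proj_center_vertex], and a vertex of the spread is closer than [gap delta t] to it; so the
    mixed distances are below [delta]. *)
Lemma join_homotopy : coord_homotopy join.
Proof.
split=> [u t r r01 ut|T G B g l r FG MB Ml g01 r01 Bl gr].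
  have gt0 := gap_gt0 delta0 ut; have gh := gap_le_half delta0 ut.
  have uth := rips_point_theta ut.
  apply: rips_point_segment => //.
  - by do 2 apply: rips_pointS (@sublevel_shift _) _.
  - by apply: rips_point_nearby_sub; [exact: psi_sublevel|rewrite gt0].
  - move=> v w tv /(nearby_gt0 (proj_in cM M0 _))[_ pw].
    have [s [sE wst ts]] := rips_point_weights uth.
    have [_ _ _ tX _] := uth.
    have pv : eucl_dist (psi (theta t)) v <= delta - gap delta t.
      have xr : distM M (center (theta t)) <= rho.
        by have [] := psi_near (@subset_refl _ M) (rips_point_in uth).
      rewrite /psi (centerE ts) in xr *.
      apply: (proj_center_vertex kappa0 kappa_rho_lt1 federer wst) => //.
      + by move=> v' v's; apply: (@sublevel_in u); apply: tX; rewrite -sE.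
      + by move=> v' w'; rewrite !sE => tv' tw'; exact: (gap_le delta0 ut tv' tw').
      + apply: le_lt_trans kappa_delta_lt1; apply: ler_wpM2l => //.
        by rewrite gerBl ltW.
      + by lra.
      + by rewrite sE.
    apply: le_lt_trans (eucl_dist_triangle (psi (theta t)) _ _) _.
    by rewrite (eucl_distC v); lra.
have Mth := rips_point_theta Ml; have cth := lf_cvg_theta FG Ml Bl.
apply: lf_cvg_segment => //; apply: lf_cvg_nearby.
- exact: proj_in.
- exact: gap_gt0 Ml.
- by apply: cvg_psi => // z; exact: rips_point_theta.
- exact: cvg_gap Ml Bl.
Qed.

Lemma coarsen_eta (X : set V) t r : 0 <= r <= 1 -> rips_point delta X t ->
  0 < (1 - r) * gap delta t + r * (delta / 2) <= delta / 2.
Proof.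
move=> /andP[r0 r1] Xt.
have g0 := gap_gt0 delta0 Xt; have gh := gap_le_half delta0 Xt.
have r10 : 0 <= 1 - r by rewrite subr_ge0.
have := ler_wpM2l r0 gh; have := ler_wpM2l r10 gh.
by move=> *; apply/andP; split; lra.
Qed.

Lemma opp01 (r : R) : 0 <= r <= 1 -> 0 <= 1 - r <= 1.
Proof. by move=> /andP[r0 r1]; rewrite subr_ge0 r1 gerBl. Qed.

Lemma coarsen_homotopy : coord_homotopy coarsen.
Proof.
split=> [u t r r01 ut|T G B g l r FG MB Ml g01 r01 Bl gr].
  apply: rips_point_nearby_sub; last exact: coarsen_eta ut.
  by apply: psi_sublevel; apply: rips_point_theta_segment => //; exact: opp01.
have cs : lf_cvg G (fun z => shrink (B z) (1 - g z)) (shrink l (1 - r)).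
  apply: (coord_cvg shrink_homotopy) => //; [by move=> z; exact: opp01|exact: opp01|].
  by apply: cvgB => //; exact: cvg_cst.
apply: lf_cvg_nearby.
- exact: proj_in.
- by have /andP[] := coarsen_eta r01 Ml.
- apply: cvg_psi => //.
    by move=> z; apply: rips_point_theta_segment => //; exact: opp01.
  by apply: rips_point_theta_segment => //; exact: opp01.
- apply: cvgD; apply: cvgM => //; last exact: cvg_cst.
    by apply: cvgB => //; exact: cvg_cst.
  exact: cvg_gap Ml Bl.
Qed.

(** The homotopies are concatenated in the localization: each gives one equality, and consecutive
    ends coincide as maps of functors. *)
Lemma phi_psi_homotopic : ho_eq
  (ho_hom (phom_comp (phom_shift eps phi_phom) psi_phom))
  (ho_hom (structure_map2 eps_ge0 RF)).
Proof.
have r01 : 0 <= (0 : R) <= 1 by rewrite lexx ler01.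
have r11 : 0 <= (1 : R) <= 1 by rewrite lexx ler01.
apply: ho_sym.
have -> : structure_map2 eps_ge0 RF = coord_phom shrink_homotopy r01.
  apply: phom_ext => u x; apply: georeal_ext => v /=.
  by rewrite /shrink subr0 mul1r mul0r addr0.
apply: ho_trans (coord_phom_ho_eq _ _ r11) _.
have -> : coord_phom shrink_homotopy r11 = coord_phom join_homotopy r01.
  apply: phom_ext => u x; apply: georeal_ext => v /=.
  by rewrite /shrink /join !subr0 subrr !mul1r !mul0r add0r addr0.
apply: ho_trans (coord_phom_ho_eq _ _ r11) _.
have -> : coord_phom join_homotopy r11 = coord_phom coarsen_homotopy r01.
  apply: phom_ext => u x; apply: georeal_ext => v /=.
  rewrite /join /coarsen !subr0 shrink1.
  by rewrite subrr !mul1r !mul0r add0r addr0.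
apply: ho_trans (coord_phom_ho_eq _ _ r11) _.
have -> : coord_phom coarsen_homotopy r11 =
    phom_comp (phom_shift eps phi_phom) psi_phom.
  apply: phom_ext => u x; apply: georeal_ext => v /=.
  by rewrite /coarsen subrr shrink0 mul0r mul1r add0r.
exact: ho_refl.
Qed.

Lemma interleaving : ho_interleaved eps MF RF.
Proof.
exists eps_ge0, (ho_hom phi_phom), (ho_hom psi_phom); split.
  exact: ho_trans (ho_sym (ho_hom_comp _ _)) psi_phi_homotopic.
exact: ho_trans (ho_sym (ho_hom_comp _ _)) phi_psi_homotopic.
Qed.

End Interleaving.

(** * From the reach to the hypotheses of the interleaving *)

Section Reach.
Variables (R : realType) (n : nat).

Lemma lt_reach_unique_proj (M : set 'rV[R]_n) x : closed M -> M !=set0 ->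
  ((distM M x)%:E < reach M)%E -> unique_proj M x.
Proof.
move=> cM M0 /ereal_sup_gt[_ [t [t0 tM] <-]]; rewrite lte_fin => xt.
have [|y [ny yP] p np] := tM x.
  apply: le_lt_trans (_ : (distM M x)%:E < _)%E; last by rewrite lte_fin.
  by apply: ereal_inf_lbound; exists (proj M x) => //; exact: proj_in.
by rewrite -(yP p np) (yP _ (proj_nearest cM M0 x)).
Qed.

Lemma reach_set0 : reach (set0 : set 'rV[R]_n) = +oo%E.
Proof.
have big (r : R) : 0 <= r -> (r%:E <= reach (set0 : set 'rV[R]_n))%E.
  move=> r0; apply: ereal_sup_ubound; exists r => //; split=> // x.
  by rewrite /dist_to image_set0 ereal_inf0.
move: big; case: (reach _) => [r| |] // big; last by have := big 0 (lexx _).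
have := big (`|r| + 1) (addr_ge0 (normr_ge0 r) ler01); rewrite lee_fin.
by rewrite leNgt ltr_pwDr// ler_norm.
Qed.

Lemma jung_lt1 : jung R n < 1.
Proof.
rewrite -(@ltr_pXn2r _ 2)// ?nnegrE ?jung_ge0// expr1n jung_sqr.
rewrite ltr_pdivrMr ?mulr_gt0//.
have : 0 <= n%:R :> R by [].
by rewrite -[n.+1%:R]natr1; lra.
Qed.

End Reach.

(** For empty [M], where there is nothing to project to: maps out of an objectwise empty functor are
    unique, so both identities hold. *)
Lemma ho_interleaved_empty (R : realType) (N : nat) (F G : pspace R N) (e : R) :
  0 <= e -> (forall u, F u -> False) -> (forall u, G u -> False) ->
  ho_interleaved e F G.
Proof.
move=> e0 F0 G0.
have empty_hom (A B : pspace R N) (A0 : forall u, A u -> False) : phom A B.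
  apply: (@PHom _ _ A B (fun u x => False_rect _ (A0 u x))) => [u x|u v uv x].
    by have := A0 u x.
  by have := A0 u x.
have uniq_hom (A B : pspace R N) (a b : phom A B) :
    (forall u, A u -> False) -> a = b.
  by move=> A0; apply: phom_ext => u x; have [] := A0 u x.
exists e0, (ho_hom (empty_hom _ _ F0)), (ho_hom (empty_hom _ _ G0)); split => /=;
  apply: ho_trans (ho_sym (ho_hom_comp _ _)) _.
- by rewrite [phom_comp _ _](uniq_hom _ _ _ (structure_map2 e0 F) F0); exact: ho_refl.
- by rewrite [phom_comp _ _](uniq_hom _ _ _ (structure_map2 e0 G) G0); exact: ho_refl.
Qed.

Theorem theorem8p18 (R : realType) (n N : nat) (M : set 'rV[R]_n)
    (f : 'rV[R]_n -> 'rV[R]_N) (L delta : R) :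
  (0 < n)%N ->
  closed M ->
  lipschitz_inf M f L ->
  0 < delta ->
  (delta%:E <=
     ((1 - jung R n) / ((1 + jung R n) * jung R n))%:E * reach M)%E ->
  ho_interleaved (distortion n (reach M) delta * L * jung R n * delta)
    (sublevel_pspace M f) (rips_pspace M f delta).
Proof.
move=> n0 cM fL d0 dM; have J2 := jung_ge_half R n0; have J1 := jung_lt1 R n.
have [M0|/set0P M0] := eqVneq M set0.
  have [L0 _] := fL; have Mn y : M y -> False by rewrite M0.
  apply: ho_interleaved_empty.
  - by rewrite M0 reach_set0/= !mulr_ge0 ?jung_ge0 ?(ltW d0).
  - by move=> u x; have [/Mn] := set_valP x.
  - move=> u t; have /rips_point_pos[v vt] := rips_point_georeal t.
    have [_ _ _ tX _] := rips_point_georeal t.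
    by have [/Mn] := tX v vt.
set c := (1 - _) / _ in dM.
have JJ : 0 < (1 + jung R n) * jung R n by rewrite mulr_gt0; lra.
have c0 : 0 < c by rewrite divr_gt0// subr_gt0.
have cJ : c * jung R n = (1 - jung R n) / (1 + jung R n).
  by rewrite /c; field; apply/andP; split; apply: lt0r_neq0; lra.
have cJ1 : c * jung R n < 1 by rewrite cJ ltr_pdivrMr; lra.
have tube := @lt_reach_unique_proj R n M _ cM M0.
have reach0 : (0%:E <= reach M)%E.
  apply: ereal_sup_ubound; exists 0 => //; split=> // x.
  rewrite ltNge => /negP[]; apply: le_ereal_inf_tmp => _ [y My <-].
  by rewrite lee_fin eucl_dist_ge0.
(* A finite reach [tau] is positive by [dM], and [kappa] is its inverse; an infinite reach gives
   [kappa = 0]; [reach0] excludes the value [-oo]. *)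
move: dM tube reach0; case: (reach M) => [tau| |] // dM tube _.
- rewrite -EFinM lee_fin in dM.
  have tau0 : 0 < tau by rewrite -(pmulr_rgt0 _ c0); exact: lt_le_trans dM.
  have Jd : jung R n * delta <= c * jung R n * tau.
    by have := ler_wpM2l (jung_ge0 R n) dM; lra.
  apply: (@interleaving R n N M f L delta tau^-1) => //.
  + by rewrite invr_ge0 ltW.
  + by rewrite -cJ mulrC ler_pdivrMr.
  + move=> x y xr My; have xtau : distM M x < tau.
      apply: le_lt_trans xr _; apply: le_lt_trans Jd _.
      by rewrite gtr_pMl.
    have tube' z : distM M z < tau -> unique_proj M z.
      by move=> zt; apply: tube; rewrite lte_fin.
    have ray := nearest_ray cM M0 tube' xtau My.
    by rewrite -mulrA ler_pdivlMl// mulrA (mulrC tau).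
  + by rewrite /= (mulrC tau^-1) mulrA.
- apply: (@interleaving R n N M f L delta 0) => //.
  + by rewrite mul0r -cJ mulr_ge0 ?jung_ge0 ?(ltW c0).
  + move=> x y _ My; rewrite !mul0r.
    have ray rho : distM M x < rho ->
        2 * rho * dot (x - proj M x) (y - proj M x)
          <= distM M x * eucl_dist y (proj M x) ^+ 2.
      by move=> xrho; apply: nearest_ray => // z _; apply: tube; rewrite ltry.
    rewrite leNgt; apply/negP => dot0; move: ray.
    set B := distM M x * _; set a := dot _ _ in dot0 * => ray.
    have B0 : 0 <= B by rewrite mulr_ge0 ?distM_ge0 ?sqr_ge0.
    have q0 : 0 <= B / (2 * a) by rewrite divr_ge0// ltW.
    have qa : B / (2 * a) * (2 * a) = B by rewrite divfK// gt_eqF.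
    have xa : 0 <= distM M x * (2 * a) by rewrite mulr_ge0 ?distM_ge0// ltW.
    (* With infinite reach [ray] holds for arbitrarily large radii, and this one is too large for a
       positive product [a]. *)
    have := ray (distM M x + 1 + B / (2 * a)).
    have -> : distM M x < distM M x + 1 + B / (2 * a) by lra.
    by move=> /(_ isT); lra.
  + by rewrite mul0r subr0 invr1.
Qed.
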